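(* Every effective quasifold groupoid is a lift-complete Lie groupoid.
   Context: A manifold is a Hausdorff second-countable space with a maximal smooth atlas. A Lie groupoid $G\rightrightarrows M$ has base $M$ a manifold, arrow space $G$ a manifold that need not be Hausdorff or second-countable, and source $s$ and target $t$ submersions with Hausdorff fibers. It is étale if $\dim G=\dim M$, i.e. $s,t$ are local diffeomorphisms. Orbits are the sets $t(s^{-1}(x))$, and $\pi:M\to M/G$ is the quotient map onto the set of orbits. For open $U\subseteq M$, $G|_U$ is the groupoid of arrows with source and target in $U$. A quasifold groupoid is a Lie groupoid $G\rightrightarrows M$ with Hausdorff arrow space such that for every $x\in M$ there is an isomorphism of Lie groupoids $\varphi:(\Gamma\ltimes\mathbb R^n)|_{\mathsf V}\to G|_U$, where $U$ is an open neighbourhood of $x$, $\mathsf V$ is an open subset of $\mathbb R^n$, and $\Gamma$ is a countable (discrete) group acting affinely on $\mathbb R^n$; here $\Gamma\ltimes\mathbb R^n$ is the action groupoid. A transition of $M$ is a diffeomorphism between open subsets of $M$. A local bisection of $G$ is a local section $\sigma$ of $s$ such that $t\sigma$ is a transition; $\Psi(G)=\{t\sigma\mid\sigma\text{ a local bisection of }G\}$. An étale $G$ is effective if the functor sending an arrow $g:x\mapsto y$ to the germ at $x$ of $t\circ s^{-1}$ (with $s^{-1}$ the local inverse of $s$ mapping $x$ to $g$) is faithful. A subset $A\subseteq M$ is totally disconnected if every smooth map from an open subset of a Cartesian space to $M$ with image in $A$ is locally constant. $G$ is lift-complete if it is étale, effective, its orbits are totally disconnected, and (LC): whenever $U\subseteq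 M$ is open and $f:U\to M$ is smooth with $\pi f=\pi|_U$, for every $x\in U$ the germ of $f$ at $x$ has a representative in $\Psi(G)$. *)

(* Defs.v *)
From HB Require Import structures.
From mathcomp Require Import all_boot all_order all_algebra.
From mathcomp Require Import all_classical all_reals all_analysis.

Set Implicit Arguments.
Unset Strict Implicit.
Unset Printing Implicit Defensive.

Import Order.TTheory GRing.Theory Num.Theory.
Import numFieldNormedType.Exports.

Local Open Scope classical_set_scope.
Local Open Scope ring_scope.

(* Partial maps are encoded as a total function together with a domain; the
   values outside the domain are junk and never matter.  In particular an
   open subset of a space is not turned into a space of its own. *)

(* [Ck k W F]: F is of class C^k on the open set W.  Asking that every
   directional derivative be C^k is asking that the differential be C^k. *)
Fixpoint Ck (R : realType) (n m k : nat) (W : set 'rV[R]_n)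
    (F : 'rV[R]_n -> 'rV[R]_m) : Prop :=
  match k with
  | 0 => forall x, W x -> {for x, continuous F}
  | k'.+1 => (forall x, W x -> differentiable F x) /\
             (forall v : 'rV[R]_n, Ck k' W (fun x => 'D_v F x))
  end.

Definition Cinfty (R : realType) (n m : nat) (W : set 'rV[R]_n)
    (F : 'rV[R]_n -> 'rV[R]_m) : Prop :=
  forall k, Ck k W F.

Record chart (R : realType) (T : Type) (n : nat) := Chart {
  chart_dom : set T;
  chart_map :> T -> 'rV[R]_n }.

Arguments Chart {R T n}.

(* A homeomorphism from an open set onto an open subset of R^n. *)
Definition is_chart (R : realType) (T : topologicalType) (n : nat)
    (c : chart R T n) : Prop :=
  [/\ open (chart_dom c),
      {in chart_dom c, continuous c},
      {in chart_dom c &, injective c} &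
      forall O, open O -> O `<=` chart_dom c -> open (c @` O)].

(* As charts are injective, [tau] below is d \o c^-1 on its domain. *)
Definition smooth_change (R : realType) (T : Type) (n : nat)
    (c d : chart R T n) : Prop :=
  exists tau : 'rV[R]_n -> 'rV[R]_n,
    Cinfty (c @` (chart_dom c `&` chart_dom d)) tau /\
    {in chart_dom c `&` chart_dom d, forall x, tau (c x) = d x}.

Definition compatible (R : realType) (T : Type) (n : nat)
    (c d : chart R T n) : Prop :=
  smooth_change c d /\ smooth_change d c.

Record smooth_space (R : realType) := SmoothSpace {
  carrier :> topologicalType;
  mdim : nat;
  atlas : set (chart R carrier mdim) }.

Arguments SmoothSpace {R}.

(* Not necessarily Hausdorff or second-countable. *)
Definition has_smooth_structure (R : realType) (X : smooth_space R) : Prop :=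
  [/\ forall c, atlas (s := X) c -> is_chart c,
      forall x : X, exists2 c, atlas (s := X) c & chart_dom c x,
      forall c d, atlas (s := X) c -> atlas (s := X) d -> compatible c d &
      forall c, is_chart c -> (forall d, atlas (s := X) d -> compatible c d) ->
        atlas (s := X) c].

Definition is_manifold (R : realType) (M : smooth_space R) : Prop :=
  [/\ has_smooth_structure M, hausdorff_space M & @second_countable M].

(* The maximal atlas containing the atlas A. *)
Definition maximal_atlas (R : realType) (T : topologicalType) (n : nat)
    (A : set (chart R T n)) : set (chart R T n) :=
  [set c | is_chart c /\ forall d, A d -> compatible c d].

Definition cartesian_space (R : realType) (n : nat) : smooth_space R :=
  SmoothSpace 'rV[R]_n n (maximal_atlas [set Chart setT id]).

Definition product_space (R : realType) (X Y : smooth_space R) :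
    smooth_space R :=
  SmoothSpace (X * Y)%type (mdim X + mdim Y)
    (maximal_atlas [set e | exists c d, [/\ atlas (s := X) c, atlas (s := Y) d &
       e = Chart (chart_dom c `*` chart_dom d)
                 (fun z => row_mx (c z.1) (d z.2))]]).

Definition rep_dom (R : realType) (X Y : smooth_space R) (A : set X)
    (f : X -> Y) (c : chart R X (mdim X)) (d : chart R Y (mdim Y)) : set X :=
  chart_dom c `&` A `&` f @^-1` chart_dom d.

(* [tau] is the coordinate expression d \o f \o c^-1 of f. *)
Definition smooth_rep (R : realType) (X Y : smooth_space R) (A : set X)
    (f : X -> Y) (c : chart R X (mdim X)) (d : chart R Y (mdim Y))
    (tau : 'rV[R]_(mdim X) -> 'rV[R]_(mdim Y)) : Prop :=
  Cinfty (c @` rep_dom A f c d) tau /\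
  {in rep_dom A f c d, forall x, tau (c x) = d (f x)}.

(* Only meaningful for A open. *)
Definition smooth_on (R : realType) (X Y : smooth_space R) (A : set X)
    (f : X -> Y) : Prop :=
  {in A, continuous f} /\
  forall c d, atlas (s := X) c -> atlas (s := Y) d ->
    exists tau, smooth_rep A f c d tau.

(* Smoothness of f on an arbitrary subset A; for an embedded submanifold A
   this is smoothness for the submanifold structure. *)
Definition smooth_on_subset (R : realType) (X Y : smooth_space R) (A : set X)
    (f : X -> Y) : Prop :=
  forall a, A a -> exists O F,
    [/\ open O, O a, smooth_on O F & {in A `&` O, f =1 F}].

Definition submersion (R : realType) (X Y : smooth_space R) (f : X -> Y) :
    Prop :=
  smooth_on setT f /\
  forall x c d tau, atlas (s := X) c -> atlas (s := Y) d ->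
    chart_dom c x -> chart_dom d (f x) -> smooth_rep setT f c d tau ->
    forall w, exists v, 'd tau (c x) v = w.

(* f : A -> B and g : B -> A are mutually inverse diffeomorphisms between
   open sets. *)
Definition inverse_diffeos (R : realType) (X Y : smooth_space R)
    (A : set X) (B : set Y) (f : X -> Y) (g : Y -> X) : Prop :=
  [/\ open A /\ open B,
      set_fun A B f /\ set_fun B A g,
      {in A, cancel f g} /\ {in B, cancel g f},
      smooth_on A f &
      smooth_on B g].

Definition diffeo_on (R : realType) (X Y : smooth_space R)
    (A : set X) (B : set Y) (f : X -> Y) : Prop :=
  exists g, inverse_diffeos A B f g.

Definition local_diffeo (R : realType) (X Y : smooth_space R) (f : X -> Y) :
    Prop :=
  forall x, exists A B, A x /\ diffeo_on A B f.

(* Transitions of M, as partial maps (O, h). *)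
Definition transition (R : realType) (M : smooth_space R) (O : set M)
    (h : M -> M) : Prop :=
  exists B : set M, diffeo_on O B h.

(* [comp_arr g h] is the composite "g after h"; it is meaningful only when
   src g = tgt h. *)
Record groupoid_data (R : realType) := GroupoidData {
  arr : smooth_space R;
  obj : smooth_space R;
  src : arr -> obj;
  tgt : arr -> obj;
  unit_arr : obj -> arr;
  inv_arr : arr -> arr;
  comp_arr : arr -> arr -> arr }.

Arguments GroupoidData {R}.

Definition composable (R : realType) (G : groupoid_data R) :
    set (product_space (arr G) (arr G)) :=
  [set z | src (g := G) z.1 = tgt (g := G) z.2].

Definition is_groupoid (R : realType) (G : groupoid_data R) : Prop :=
  [/\ (forall x : obj G, src (unit_arr x) = x /\ tgt (unit_arr x) = x),
      (forall g : arr G, src (inv_arr g) = tgt g /\ tgt (inv_arr g) = src g),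
      (forall g h : arr G, src g = tgt h ->
         src (comp_arr g h) = src h /\ tgt (comp_arr g h) = tgt g),
      (forall g h k : arr G, src g = tgt h -> src h = tgt k ->
         comp_arr g (comp_arr h k) = comp_arr (comp_arr g h) k) &
      (forall g : arr G,
         [/\ comp_arr g (unit_arr (src g)) = g, comp_arr (unit_arr (tgt g)) g = g,
             comp_arr (inv_arr g) g = unit_arr (src g) &
             comp_arr g (inv_arr g) = unit_arr (tgt g)])].

(* In [subspace A] the points outside A are isolated, so that it is Hausdorff
   if and only if A is Hausdorff for the relative topology. *)
Definition hausdorff_fibers (R : realType) (X Y : smooth_space R)
    (f : X -> Y) : Prop :=
  forall y, hausdorff_space (subspace (f @^-1` [set y])).

Definition is_lie_groupoid (R : realType) (G : groupoid_data R) : Prop :=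
  [/\ is_groupoid G,
      is_manifold (obj G) /\ has_smooth_structure (arr G),
      submersion (@src _ G) /\ submersion (@tgt _ G),
      hausdorff_fibers (@src _ G) /\ hausdorff_fibers (@tgt _ G) &
      [/\ smooth_on setT (@unit_arr _ G), smooth_on setT (@inv_arr _ G) &
          smooth_on_subset (@composable _ G)
            (fun z : product_space (arr G) (arr G) => comp_arr z.1 z.2 : arr G)]].

(* The dimension of an empty space is meaningless, whence the guard. *)
Definition etale (R : realType) (G : groupoid_data R) : Prop :=
  [/\ arr G -> mdim (arr G) = mdim (obj G),
      local_diffeo (@src _ G) &
      local_diffeo (@tgt _ G)].

(* The class pi(x) of x in the orbit space, as a subset of the base. *)
Definition gorbit (R : realType) (G : groupoid_data R) (x : obj G) :
    set (obj G) :=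
  @tgt _ G @` (@src _ G @^-1` [set x]).

(* The arrow space of the restriction of G to U. *)
Definition arrows_over (R : realType) (G : groupoid_data R)
    (U : set (obj G)) : set (arr G) :=
  [set g | U (src g) /\ U (tgt g)].

(* (phi1, phi0) is an isomorphism of Lie groupoids from the restriction of H
   to the open set V onto the restriction of G to the open set U. *)
Definition lie_iso_on (R : realType) (H G : groupoid_data R)
    (V : set (obj H)) (U : set (obj G))
    (phi1 : arr H -> arr G) (phi0 : obj H -> obj G) : Prop :=
  [/\ diffeo_on V U phi0,
      diffeo_on (arrows_over V) (arrows_over U) phi1,
      {in arrows_over V, forall g,
        src (phi1 g) = phi0 (src g) /\ tgt (phi1 g) = phi0 (tgt g)} &
      {in arrows_over V &, forall g h, src g = tgt h ->
        phi1 (comp_arr g h) = comp_arr (phi1 g) (phi1 h)}].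

Definition affine_map (R : realType) (n : nat) (f : 'rV[R]_n -> 'rV[R]_n) :
    Prop :=
  exists (A : 'M[R]_n) (b : 'rV[R]_n), forall x, f x = x *m A + b.

Definition affine_action (R : realType) (n : nat) (Gamma : groupType)
    (a : Gamma -> 'rV[R]_n -> 'rV[R]_n) : Prop :=
  [/\ forall x, a 1%g x = x,
      forall g h x, a (g * h)%g x = a g (a h x) &
      forall g, affine_map (a g)].

(* The arrow space of the action groupoid: Gamma x R^n with Gamma discrete. *)
Definition action_arr (R : realType) (n : nat) (Gamma : groupType) :
    smooth_space R :=
  SmoothSpace (discrete_topology Gamma * 'rV[R]_n)%type n
    (maximal_atlas
       [set c : chart R (discrete_topology Gamma * 'rV[R]_n)%type n |
          exists g, c = Chart [set z | z.1 = g] snd]).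

Definition action_groupoid (R : realType) (n : nat) (Gamma : groupType)
    (a : Gamma -> 'rV[R]_n -> 'rV[R]_n) : groupoid_data R :=
  GroupoidData (action_arr R n Gamma) (cartesian_space R n)
    (fun z => z.2)
    (fun z => a z.1 z.2)
    (fun x => (1%g : Gamma, x))
    (fun z => ((z.1 : Gamma)^-1%g, a z.1 z.2))
    (fun z w => (((z.1 : Gamma) * (w.1 : Gamma))%g, w.2)).

Definition quasifold_groupoid (R : realType) (G : groupoid_data R) : Prop :=
  [/\ is_lie_groupoid G,
      hausdorff_space (arr G) &
      forall x : obj G,
        exists (n : nat) (Gamma : groupType)
               (a : Gamma -> 'rV[R]_n -> 'rV[R]_n)
               (V : set (obj (action_groupoid a))) (U : set (obj G))
               (phi1 : arr (action_groupoid a) -> arr G)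
               (phi0 : obj (action_groupoid a) -> obj G),
          [/\ countable [set: Gamma], affine_action a, open V,
              open_nbhs x U & lie_iso_on V U phi1 phi0]].

Definition local_bisection (R : realType) (G : groupoid_data R)
    (O : set (obj G)) (sigma : obj G -> arr G) : Prop :=
  [/\ open O, smooth_on O sigma, {in O, cancel sigma (@src _ G)} &
      transition O (@tgt _ G \o sigma)].

(* The elements of Psi(G), as partial maps (O, h). *)
Definition Psi (R : realType) (G : groupoid_data R) (O : set (obj G))
    (h : obj G -> obj G) : Prop :=
  exists2 sigma, local_bisection O sigma & {in O, h =1 @tgt _ G \o sigma}.

(* sigma is the local inverse of the source map sending src g to g. *)
Definition source_inverse (R : realType) (G : groupoid_data R) (g : arr G)
    (sigma : obj G -> arr G) : Prop :=
  exists A B, A g /\ inverse_diffeos A B (@src _ G) sigma.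

(* Faithfulness of the functor sending g to the germ at src g of
   tgt \o src^-1.  Etaleness is not part of the definition; when it holds,
   local inverses of the source exist and have unique germs. *)
Definition effective (R : realType) (G : groupoid_data R) : Prop :=
  forall g h : arr G, src g = src h -> tgt g = tgt h ->
  forall sigma tau : obj G -> arr G,
    source_inverse g sigma -> source_inverse h tau ->
    (\forall y \near src g, tgt (sigma y) = tgt (tau y)) -> g = h.

(* Total disconnectedness in the diffeological sense, which is weaker than
   the topological one of the library. *)
Definition smoothly_totally_disconnected (R : realType) (M : smooth_space R)
    (A : set M) : Prop :=
  forall (k : nat) (W : set (cartesian_space R k))
         (p : cartesian_space R k -> M),
    open W -> smooth_on W p -> set_fun W A p ->
    forall w, W w -> \forall w' \near w, p w' = p w.

Definition lift_complete (R : realType) (G : groupoid_data R) : Prop :=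
  [/\ is_lie_groupoid G,
      etale G,
      effective G,
      forall x : obj G, smoothly_totally_disconnected (gorbit x) &
      forall (U : set (obj G)) (f : obj G -> obj G),
        open U -> smooth_on U f -> {in U, forall x, gorbit (f x) = gorbit x} ->
        forall x, U x -> exists O h,
          [/\ Psi O h, O x & \forall y \near x, f y = h y]].

(* Main.v *)
Require Import Defs.
From mathcomp Require Import all_boot all_order all_algebra.
From mathcomp Require Import ring lra.
From mathcomp Require Import all_classical all_reals all_analysis.

(* Locally G is the action groupoid of a countable group of affine maps.

   G is étale: dim G = dim M can be read off in a model.  As the source map is
   injective near units and (h, k) |-> h k^-1 is continuous, it is injective
   near every arrow; an injective smooth map with surjective differentials
   between spaces of the same dimension is open, and its inverse is smooth.

   Orbits are totally disconnected: in a model an orbit is countable, and a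
   continuous map from a ball to R^n with countable image is constant.

   (LC): composing f with the target of a local section through an arrow from
   f(x) to x, we get a map near x that fixes x, hence, in a model, a smooth map F
   on a ball such that F(v) is one of the countably many a_i(v) for every v.
   On a line, the derivative of F takes countably many values (at an
   accumulation point of {F = a_i} it is that of a_i, and the isolated points
   of these sets are countably many), so it is constant.  Hence F is affine, and
   it is a single a_i, which follows by comparing F with the a_i along a moment
   curve.  Thus f near x lifts to a continuous section of the source map, and,
   G being étale, this section is a local bisection. *)

Set Implicit Arguments.
Unset Strict Implicit.
Unset Printing Implicit Defensive.

Import Order.TTheory GRing.Theory Num.Theory.
Import numFieldNormedType.Exports.

Local Open Scope classical_set_scope.
Local Open Scope ring_scope.

(** * Differentials through epsilon estimates *)

Section Differentials.
Variables (R : realType) (V W : normedModType R).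
Implicit Types (f g : V -> W) (x v : V).

Lemma is_diff_eps f x (df : {linear V -> W}) : continuous df ->
  (forall e : R, 0 < e ->
     \forall h \near (0 : V), `|f (h + x) - f x - df h| <= e * `|h|) ->
  is_diff x f df.
Proof.
move=> cdf H.
have H1 : f \o shift x = cst (f x) + (df : V -> W) +o_ (0 : V) id.
  apply/eqaddoP => e e0; near=> h.
  rewrite !fctE /= opprD addrA.
  by near: h; exact: H.
have dE := diff_unique cdf H1.
apply: DiffDef => //; apply/diff_locallyP; rewrite dE; split => //.
Unshelve. all: by end_near. Qed.

Lemma diff_eps f x (e : R) : differentiable f x -> 0 < e ->
  \forall h \near (0 : V), `|f (h + x) - f x - 'd f x h| <= e * `|h|.
Proof.
move=> /diff_locally /eqaddoP /(_ e) H /H; apply: filterS => h.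
by rewrite !fctE /= opprD addrA.
Qed.

Lemma near_eq_is_diff f g x : {near x, f =1 g} -> differentiable f x ->
  is_diff x g ('d f x).
Proof.
move=> fg df; apply: is_diff_eps => [|e e0]; first exact: diff_continuous.
have gx := nbhs_singleton fg.
have fg0 : \forall h \near (0 : V), f (h + x) = g (h + x).
  by move: fg; rewrite (near_shift 0) /=; under [X in X -> _]eq_near do rewrite /= subr0.
by move: fg0 (diff_eps df e0); apply: filterS2 => h /= <-; rewrite -gx.
Qed.

Lemma near_eq_differentiable f g x : {near x, f =1 g} ->
  differentiable f x -> differentiable g x.
Proof. by move=> fg df; case: (near_eq_is_diff fg df). Qed.

End Differentials.

(** * Continuity and differentiability by coordinates *)

Section RowVectors.
Variables (R : realType).

Lemma continuous_coordP (T : topologicalType) (n : nat) (F : T -> 'rV[R]_n) x :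
  {for x, continuous F} <-> forall j, {for x, continuous (fun y => F y 0 j)}.
Proof.
split=> [cF j|cF]; first exact: (continuous_comp cF (@coord_continuous _ _ _ 0 j _)).
apply/cvgrPdist_le => e e0.
have : \forall y \near x, forall j, `|F x 0 j - F y 0 j| <= e.
  apply: filter_forall => j; have /cvgrPdist_le := cF j; exact.
apply: filterS => y H; rewrite /Num.Def.normr /= mx_normrE.
by apply: bigmax_le; [exact: ltW|case=> i j _; rewrite !mxE ord1].
Qed.

Lemma continuous_linear_rV (n : nat) (V : normedModType R)
  (f : {linear 'rV[R]_n -> V}) : continuous f.
Proof.
have -> : (f : 'rV_n -> V) = \sum_(j < n) (fun v : 'rV[R]_n => v 0 j *: f 'e_j).
  apply/funext => v; rewrite {1}(row_sum_delta v) linear_sum fct_sumE.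
  by apply: eq_bigr => j _; rewrite linearZ.
move=> x; apply: (@big_ind _ (fun g : 'rV[R]_n -> V => {for x, continuous g})).
- exact: cst_continuous.
- by move=> g h cg ch; exact: continuousD.
- by move=> j _; apply: cvgZr_tmp (@coord_continuous R 1 n 0 j x).
Qed.

Lemma differentiable_coordP (V : normedModType R) (n : nat)
    (F : V -> 'rV[R]_n) x :
  differentiable F x <-> forall j, differentiable (fun y => F y 0 j) x.
Proof.
split=> [dF j|dF].
  exact: (differentiable_comp dF (differentiable_coord _ _ _)).
have -> : F = \sum_(j < n) (fun y => F y 0 j *: ('e_j : 'rV[R]_n)).
  apply/funext => y; rewrite {1}(row_sum_delta (F y)) fct_sumE.
  by [].
apply: differentiable_sum => j; exact: differentiableZl.
Qed.

Lemma derive_coord (V : normedModType R) (n : nat) (F : V -> 'rV[R]_n) x v j :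
  differentiable F x -> 'D_v F x 0 j = 'D_v (fun y => F y 0 j) x.
Proof. by move=> dF; rewrite derive_mx ?mxE //; exact: diff_derivable. Qed.

End RowVectors.

(** * C^k calculus *)

Section ScalarCk.
Variables (R : realType) (n : nat).
Implicit Types (W O : set 'rV[R]_n) (f g : 'rV[R]_n -> R).

(** The scalar counterpart of [Ck]: products, inverses and determinants live here, and [Ck_coordP]
    carries the results over to vector-valued maps. *)
Fixpoint sCk (k : nat) (W : set 'rV[R]_n) (f : 'rV[R]_n -> R) : Prop :=
  match k with
  | 0 => forall x, W x -> {for x, continuous f}
  | k'.+1 => (forall x, W x -> differentiable f x) /\
             (forall v : 'rV[R]_n, sCk k' W (fun x => 'D_v f x))
  end.

Lemma near_open W x f g : open W -> W x -> (forall y, W y -> f y = g y) ->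
  {near x, f =1 g}.
Proof. by move=> oW Wx fg; apply: filterS (open_nbhs_nbhs (conj oW Wx)). Qed.

Lemma sCk_eq k W f g : open W -> (forall x, W x -> f x = g x) ->
  sCk k W f -> sCk k W g.
Proof.
move=> oW; elim: k f g => [|k IH] f g fg /=.
  move=> cf x Wx; have nfg := near_open oW Wx fg.
  rewrite /prop_for /continuous_at -fg //.
  exact: cvg_trans (near_eq_cvg nfg) (cf x Wx).
move=> [df cf]; split=> [x Wx|v].
  exact: near_eq_differentiable (near_open oW Wx fg) (df x Wx).
by apply: IH (cf v) => x Wx; apply: near_eq_derive; exact: near_open fg.
Qed.

Lemma sCk_continuous k W f x : sCk k W f -> W x -> {for x, continuous f}.
Proof.
by case: k => [|k] /= cf Wx; [exact: cf|apply/differentiable_continuous/cf.1].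
Qed.

Lemma sCk_pred k W f : sCk k.+1 W f -> sCk k W f.
Proof.
elim: k f => [|k IH] f cf; first by move=> x; exact: sCk_continuous cf.
by case: cf => df cf; split=> // v; exact: IH.
Qed.

Lemma sCk_cst k W (a : R) : sCk k W (fun=> a).
Proof.
elim: k a => [|k IH] a /=; first by move=> x _; exact: cst_continuous.
split=> [x _|v]; first exact: differentiable_cst.
have -> : (fun x => 'D_v (fun=> a) x) = (fun=> 0 : R).
  by apply/funext => x; exact: derive_cst.
exact: IH.
Qed.

Lemma sCkD k W f g : open W -> sCk k W f -> sCk k W g ->
  sCk k W (fun x => f x + g x).
Proof.
move=> oW; elim: k f g => [|k IH] f g /=.
  by move=> cf cg x Wx; apply: continuousD; [exact: cf|exact: cg].
move=> [df cf] [dg cg]; split=> [x Wx|v].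
  by apply: differentiableD; [exact: df|exact: dg].
apply: sCk_eq (IH _ _ (cf v) (cg v)) => // x Wx.
by rewrite -deriveD //; apply: diff_derivable; [exact: df|exact: dg].
Qed.

Lemma sCkM k W f g : open W -> sCk k W f -> sCk k W g ->
  sCk k W (fun x => f x * g x).
Proof.
move=> oW; elim: k f g => [|k IH] f g.
  by move=> cf cg x Wx; exact: cvgM (cf x Wx) (cg x Wx).
move=> cf cg; have [cf' cg'] := (sCk_pred cf, sCk_pred cg).
case: cf cg => [df cf] [dg cg]; split=> [x Wx|v].
  by apply: differentiableM; [exact: df|exact: dg].
apply: sCk_eq (sCkD oW (IH _ _ cf' (cg v)) (IH _ _ cg' (cf v))) => // x Wx.
by rewrite -[LHS]deriveM //; apply: diff_derivable; [exact: df|exact: dg].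
Qed.

Lemma sCk_sum (I : Type) (r : seq I) k W (f : I -> 'rV[R]_n -> R) : open W ->
  (forall i, sCk k W (f i)) -> sCk k W (fun x => \sum_(i <- r) f i x).
Proof.
move=> oW cf; elim: r => [|i r IH].
  by apply: sCk_eq (sCk_cst k W 0) => // x _; rewrite big_nil.
by apply: sCk_eq (sCkD oW (cf i) IH) => // x _; rewrite big_cons.
Qed.

Lemma sCk_prod (I : Type) (r : seq I) k W (f : I -> 'rV[R]_n -> R) : open W ->
  (forall i, sCk k W (f i)) -> sCk k W (fun x => \prod_(i <- r) f i x).
Proof.
move=> oW cf; elim: r => [|i r IH].
  by apply: sCk_eq (sCk_cst k W 1) => // x _; rewrite big_nil.
by apply: sCk_eq (sCkM oW (cf i) IH) => // x _; rewrite big_cons.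
Qed.

Lemma sCkV k W f : open W -> (forall x, W x -> f x != 0) -> sCk k W f ->
  sCk k W (fun x => (f x)^-1).
Proof.
move=> oW f0; elim: k => [|k IH].
  by move=> cf x Wx; exact: cvgV (f0 x Wx) (cf x Wx).
move=> cf; have cf' := IH (sCk_pred cf).
case: cf => [df cf]; split=> [x Wx|v].
  by apply: differentiableV; [exact: df|exact: f0].
have H := sCkM oW (sCk_cst k W (-1)) (sCkM oW (sCkM oW cf' cf') (cf v)).
apply: sCk_eq H => // x Wx /=; rewrite deriveV //; last 2 first.
- exact: f0.
- exact: diff_derivable (df x Wx).
by rewrite -[RHS]/(- (f x ^- 2) * 'D_v f x) -exprVn expr2 mulN1r mulNr.
Qed.

Lemma sCk_det k W m (A : 'rV[R]_n -> 'M[R]_m) : open W ->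
  (forall i j, sCk k W (fun x => A x i j)) -> sCk k W (fun x => \det (A x)).
Proof.
move=> oW cA; rewrite /determinant.
apply: sCk_sum => // s; apply: sCkM => //; first exact: sCk_cst.
exact: sCk_prod.
Qed.

(** By Cramer's rule an entry of the inverse is a cofactor, polynomial in the entries of A, divided
    by the determinant. *)
Lemma sCk_invmx k W m (A : 'rV[R]_n -> 'M[R]_m) i j : open W ->
  (forall x, W x -> A x \in unitmx) ->
  (forall i j, sCk k W (fun x => A x i j)) ->
  sCk k W (fun x => invmx (A x) i j).
Proof.
move=> oW uA cA.
have cof : sCk k W (fun x => \adj (A x) i j).
  have := sCkM oW (sCk_cst k W ((-1) ^+ (j + i)))
    (@sCk_det k W _ (fun x => row' j (col' i (A x))) oW _).
  have e : (fun x => \adj (A x) i j) =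
      (fun x => (-1) ^+ (j + i) * \det (row' j (col' i (A x)))).
    by apply/funext => x; rewrite mxE.
  rewrite e; apply => a b; apply: sCk_eq (cA (lift j a) (lift i b)) => // x _.
  by rewrite !mxE.
have dV : sCk k W (fun x => (\det (A x))^-1).
  apply: sCkV => //; last exact: sCk_det.
  by move=> x /uA; rewrite unitmxE unitfE.
by apply: sCk_eq (sCkM oW dV cof) => // x Wx; rewrite /invmx uA // [RHS]mxE.
Qed.

End ScalarCk.

Section VectorCk.
Variables (R : realType).

Lemma Ck_coordP (n m k : nat) (W : set 'rV[R]_n) (F : 'rV[R]_n -> 'rV[R]_m) :
  open W -> Ck k W F <-> (forall j, sCk k W (fun x => F x 0 j)).
Proof.
move=> oW; elim: k F => [|k IH] F /=.
  split=> [cF j x Wx|cF x Wx]; first exact: (continuous_coordP F x).1 (cF x Wx) j.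
  by apply/continuous_coordP => j; exact: cF.
split=> [[dF cF] j|cF].
  split=> [x Wx|v]; first exact: (differentiable_coordP F x).1 (dF x Wx) j.
  apply: sCk_eq ((IH _).1 (cF v) j) => // x Wx.
  by apply: derive_coord; exact: dF.
have dF x : W x -> differentiable F x.
  by move=> Wx; apply/differentiable_coordP => j; exact: (cF j).1.
split=> // v; apply/IH => j; apply: sCk_eq ((cF j).2 v) => // x Wx.
by apply/esym/derive_coord; exact: dF.
Qed.

(** Induction on k through the chain rule: a directional derivative of the composite is the sum over
    j of the derivative of the coordinate j of G times the partial derivative ['D_('e_j) f] composed
    with G. *)
Lemma sCk_comp (n m k : nat) (W : set 'rV[R]_n) (W' : set 'rV[R]_m)
    (G : 'rV[R]_n -> 'rV[R]_m) (f : 'rV[R]_m -> R) :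
  open W -> (forall x, W x -> W' (G x)) ->
  Ck k W G -> sCk k W' f -> sCk k W (f \o G).
Proof.
move=> oW WW'; elim: k f => [|k IH] f cG cf.
  by move=> x Wx; apply: continuous_comp; [exact: cG|apply: cf; exact: WW'].
have cG' : Ck k W G.
  by apply/Ck_coordP => // j; apply: sCk_pred; exact: (Ck_coordP _ _ oW).1 cG j.
have cGj := (Ck_coordP _ _ oW).1 cG.
case: cf cG => [df cf] [dG _].
have dfG x : W x -> differentiable (f \o G) x.
  move=> Wx; apply: differentiable_comp; first exact: dG.
  by apply: df; exact: WW'.
split=> // v.
apply: (@sCk_eq _ _ _ _ (fun x => \sum_(j < m)
  ('D_v (fun y => G y 0 j) x * 'D_('e_j) f (G x)))) => // [x Wx|].
  have dfx : differentiable f (G x) by apply: df; exact: WW'.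
  rewrite [RHS]deriveE; last exact: dfG.
  rewrite (diff_comp (dG x Wx) dfx) /= -(deriveE _ (dG x Wx)).
  rewrite [in RHS](row_sum_delta ('D_v G x)) linear_sum; apply: eq_bigr => j _.
  by rewrite linearZ /= (deriveE _ dfx) derive_coord //; exact: dG.
apply: sCk_sum => // j; apply: sCkM => //; first exact: (cGj j).2.
exact: (IH ('D_('e_j) f) cG' (cf 'e_j)).
Qed.

Lemma Ck_comp (n m p k : nat) (W : set 'rV[R]_n) (W' : set 'rV[R]_m)
    (G : 'rV[R]_n -> 'rV[R]_m) (F : 'rV[R]_m -> 'rV[R]_p) :
  open W -> open W' -> (forall x, W x -> W' (G x)) ->
  Ck k W G -> Ck k W' F -> Ck k W (F \o G).
Proof.
move=> oW oW' WW' cG cF; apply/Ck_coordP => // j.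
exact: (sCk_comp oW WW' cG ((Ck_coordP _ _ oW').1 cF j)).
Qed.

Lemma Ck_eq (n m k : nat) (W : set 'rV[R]_n) (F G : 'rV[R]_n -> 'rV[R]_m) :
  open W -> (forall x, W x -> F x = G x) -> Ck k W F -> Ck k W G.
Proof.
move=> oW FG /(Ck_coordP _ _ oW) cF; apply/Ck_coordP => // j.
by apply: sCk_eq (cF j) => // x Wx; rewrite FG.
Qed.

(** [Ck] is a pointwise condition on a total function and its iterated derivatives, so it can be
    checked on a cover. *)
Lemma Ck_local (n m k : nat) (W : set 'rV[R]_n) (F : 'rV[R]_n -> 'rV[R]_m) :
  (forall x, W x -> exists2 O, O x & Ck k O F) -> Ck k W F.
Proof.
elim: k F => [|k IH] F H /=; first by move=> x /H[U Ux]; apply.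
split=> [x /H[U Ux [dO _]]|v]; first exact: dO.
by apply: IH => x /H[U Ux [_ /(_ v)]]; exists U.
Qed.

Lemma Ck_sub (n m k : nat) (W O : set 'rV[R]_n) (F : 'rV[R]_n -> 'rV[R]_m) :
  O `<=` W -> Ck k W F -> Ck k O F.
Proof. by move=> OW cF; apply: Ck_local => x /OW Wx; exists W. Qed.

Lemma Ck_id (n k : nat) (W : set 'rV[R]_n) : Ck k W id.
Proof.
apply: (@Ck_sub _ _ _ setT) => //; case: k => [|k] /=; first by move=> x _; exact: cvg_id.
split=> [x _|v]; first exact: ex_diff.
apply/Ck_coordP => [|j]; first exact: openT.
have -> : (fun x : 'rV[R]_n => 'D_v id x 0 j) = (fun=> v 0 j).
  by apply/funext => x; rewrite derive_id.
exact: sCk_cst.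
Qed.

End VectorCk.

(** * Openness of injective maps with surjective differentials *)

Section Openness.
Variables (R : realType).

Lemma is_derive_line (V W : normedModType R) (f : V -> W) (x v : V) (t : R) :
  differentiable f (t *: v + x) ->
  is_derive t 1 (fun s : R => f (s *: v + x)) ('D_v f (t *: v + x)).
Proof.
move=> df; pose l := fun s : R => s *: v + x.
have dl : is_diff t l (fun s : R => s *: v).
  have -> : l = (fun s : R => s *: v) + cst x by apply/funext.
  by apply: is_diff_eq; rewrite addr0.
have dfl : differentiable (f \o l) t by apply: differentiable_comp => //; exact: ex_diff.
apply: DeriveDef; first exact: (diff_derivable dfl).
rewrite (deriveE _ dfl) diff_comp //=.
by rewrite (@diff_val _ _ _ _ _ _ _ dl) scale1r (deriveE _ df).
Qed.

Lemma compact_norm_preimage (n : nat) (x0 : 'rV[R]_n) (r : R) (D : set R) :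
  closed D -> D `<=` [set s | s <= r] -> compact [set x | D `|x - x0|].
Proof.
move=> cD Dr; apply: bounded_closed_compact.
  exists (r + `|x0|); split; first exact: num_real.
  move=> M rM x /= /Dr /= xr; apply/ltW; apply: le_lt_trans rM.
  by rewrite -{1}(subrK x0 x) (le_trans (ler_normD _ _)) // lerD2r.
apply: (@preimage_closed _ _ (fun x : 'rV[R]_n => `|x - x0|)) cD => x _.
apply: continuous_comp; last exact: norm_continuous.
exact: cvgB cvg_id (cvg_cst _).
Qed.

(* The Euclidean norm, squared; the norm of the library on row vectors is the
   sup norm, which is not differentiable. *)
Definition sqnorm (m : nat) (z : 'rV[R]_m) : R := \sum_(i < m) z 0 i ^+ 2.

Lemma sqnorm_ge0 m (z : 'rV[R]_m) : 0 <= sqnorm z.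
Proof. by apply: sumr_ge0 => i _; exact: sqr_ge0. Qed.

Lemma sqnorm_eq0 m (z : 'rV[R]_m) : sqnorm z = 0 -> z = 0.
Proof.
move=> /eqP; rewrite /sqnorm psumr_eq0 => [/allP z0|i _]; last exact: sqr_ge0.
apply/rowP => i; rewrite mxE.
by have := z0 i; rewrite mem_index_enum sqrf_eq0 => /(_ isT)/eqP.
Qed.

Lemma sqnormD m (a b : 'rV[R]_m) : sqnorm (a + b) <= 2 * sqnorm a + 2 * sqnorm b.
Proof.
rewrite /sqnorm !mulr_sumr -big_split /=; apply: ler_sum => i _.
rewrite mxE -subr_ge0.
have -> : 2 * a 0 i ^+ 2 + 2 * b 0 i ^+ 2 - (a 0 i + b 0 i) ^+ 2 = (a 0 i - b 0 i) ^+ 2.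
  by ring.
exact: sqr_ge0.
Qed.

Lemma sqnormN m (a : 'rV[R]_m) : sqnorm (- a) = sqnorm a.
Proof. by apply: eq_bigr => i _; rewrite mxE sqrrN. Qed.

Lemma continuous_sqnorm m : continuous (@sqnorm m).
Proof.
move=> z; have -> : @sqnorm m = \sum_(i < m) (fun z : 'rV[R]_m => z 0 i ^+ 2).
  by apply/funext => y; rewrite fct_sumE.
apply: (@big_ind _ (fun g : 'rV[R]_m -> R => {for z, continuous g})).
- exact: cst_continuous.
- by move=> g h cg ch; exact: continuousD.
- move=> i _; exact: continuous_comp (@coord_continuous R 1 m 0 i z)
    (@exprn_continuous _ _ _).
Qed.

(** Choose v with ['d F c v = F c - y]. Along the line through c in direction v, the squared
    distance to y has derivative [2 * sqnorm (F c - y)] at c, and this vanishes at a minimum. *)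
Lemma sqnorm_local_min (n m : nat) (F : 'rV[R]_n -> 'rV[R]_m) (y : 'rV[R]_m) c :
  (forall w, exists v, 'd F c v = w) ->
  (\forall x \near c, differentiable F x /\
     sqnorm (F c - y) <= sqnorm (F x - y)) ->
  F c = y.
Proof.
move=> surj near_c.
have dFc : differentiable F c by have [] := nbhs_singleton near_c.
have [v dv] := surj (F c - y).
pose psi i := fun t : R => F (t *: v + c) 0 i - y 0 i.
pose phi : R -> R := \sum_(i < m) (psi i) ^+ 2.
have phiE t : phi t = sqnorm (F (t *: v + c) - y).
  by rewrite /phi fct_sumE; apply: eq_bigr => i _; rewrite !mxE.
have cl : {for 0, continuous (fun t : R => t *: v + c)}.
  apply: cvgD; last exact: cvg_cst.
  exact: cvgZr_tmp.
have : \forall t \near (0 : R), differentiable F (t *: v + c) /\ phi 0 <= phi t.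
  have := cl; rewrite /prop_for /continuous_at scale0r add0r => /(_ _ near_c).
  move=> H; have {}H : \forall t \near (0 : R), differentiable F (t *: v + c) /\
    sqnorm (F c - y) <= sqnorm (F (t *: v + c) - y) by exact: H.
  apply: filterS H => t [dF]; rewrite !phiE scale0r add0r; by split.
move=> /nbhs_ballP[e /= e0 be].
have ine (t : R) : t \in `]- e, e[%R -> ball 0 e t.
  by rewrite in_itv /= /ball /= sub0r normrN ltr_norml.
have dpsi i t : differentiable F (t *: v + c) ->
    is_derive t 1 (psi i) ('D_v F (t *: v + c) 0 i).
  move=> dF; rewrite derive_coord //.
  have := is_derive_line ((differentiable_coordP F _).1 dF i).
  move=> D; have -> : psi i = (fun s : R => F (s *: v + c) 0 i) - cst (y 0 i).
    by apply/funext.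
  by apply: is_derive_eq; rewrite subr0.
have dphi t : differentiable F (t *: v + c) ->
    is_derive t 1 phi (\sum_(i < m) (2%:R * psi i t ^+ 1) *: 'D_v F (t *: v + c) 0 i).
  by move=> dF; apply: is_derive_sum => i; apply: is_deriveX; exact: dpsi.
have dm : is_derive (0 : R) 1 phi 0.
  apply: (@derive1_at_min _ _ (- e) e).
  - by rewrite ge0_cp // ltW.
  - by move=> t /ine /be [dF _]; have [] := dphi t dF.
  - by rewrite in_itv /= oppr_lt0 e0.
  - by move=> t /ine /be [].
have dF0 : differentiable F (0 *: v + c) by rewrite scale0r add0r.
have := dphi 0 dF0; have [_ e1] := dm; move=> [_]; rewrite e1.
rewrite scale0r add0r (deriveE _ dFc) dv => /esym s0.
apply/subr0_eq/sqnorm_eq0.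
have : 2 * sqnorm (F c - y) = 0.
  rewrite -s0 mulr_sumr; apply: eq_bigr => i _.
  rewrite /psi scale0r add0r !mxE expr1 expr2 mulrA; by [].
by move/eqP; rewrite mulf_eq0 pnatr_eq0 /= => /eqP.
Qed.

(** For y close to [F x0], let c minimize the squared distance from F to y on a closed ball around
    x0. By injectivity and compactness F stays away from [F x0] on the bounding sphere, so c is
    interior and [sqnorm_local_min] gives [F c = y]. *)
Lemma open_image (n m : nat) (W : set 'rV[R]_n) (F : 'rV[R]_n -> 'rV[R]_m) :
  open W -> (forall x, W x -> differentiable F x) ->
  (forall x y, W x -> W y -> F x = F y -> x = y) ->
  (forall x, W x -> forall w, exists v, 'd F x v = w) ->
  open (F @` W).
Proof.
move=> oW dF injF surjF; rewrite openE => _ [x0 Wx0 <-].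
have [r r0 rW] : exists2 r : R, 0 < r & forall x, `|x - x0| <= r -> W x.
  have /nbhs_ballP[e /= e0 eW] := open_nbhs_nbhs (conj oW Wx0).
  exists (e / 2) => [|x xe]; first by rewrite divr_gt0.
  apply: eW; rewrite -ball_normE /= distrC (le_lt_trans xe) //.
  by rewrite ltr_pdivrMr // ltr_pMr // ltr1n.
pose B := [set x : 'rV[R]_n | `|x - x0| <= r].
pose S := [set x : 'rV[R]_n | `|x - x0| = r].
have cB : compact B.
  by apply: (@compact_norm_preimage _ _ r [set s | s <= r]) => //; exact: closed_le.
have cS : compact S.
  apply: (@compact_norm_preimage _ _ r [set r]); first exact: closed_eq.
  by move=> s /= ->.
have SB : S `<=` B by move=> x; rewrite /S /B /= => ->.
have cN (y : 'rV[R]_m) (A : set 'rV[R]_n) : A `<=` W ->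
    {within A, continuous (fun x => sqnorm (F x - y))}.
  move=> AW; apply: continuous_in_subspaceT => x /set_mem /AW Wx.
  apply: continuous_comp; last exact: continuous_sqnorm.
  exact: cvgB (differentiable_continuous (dF x Wx)) (cvg_cst _).
have [d d0 dS] : exists2 d : R, 0 < d & forall x, S x -> d <= sqnorm (F x - F x0).
  (* The sphere is empty in dimension 0, and any positive d then serves. *)
  have [S0|/set0P S0] := eqVneq S set0.
    by exists 1 => // x; rewrite S0.
  have [c Sc cmin] := EVT_min_rV S0 cS (cN (F x0) _ (subset_trans SB rW)).
  exists (sqnorm (F c - F x0)) => [|x Sx]; last by apply: cmin; exact: mem_set.
  rewrite lt_neqAle sqnorm_ge0 andbT; apply/eqP => /esym/sqnorm_eq0/subr0_eq /injF H.
  move: (set_mem Sc); rewrite /S /= H //; last exact/rW/SB/set_mem.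
  by rewrite subrr normr0 => re; rewrite re ltxx in r0.
(* The bound [d / 4] keeps the minimizer c off the sphere: there [d <= 2 * sqnorm (F c - y) + 2 *
   sqnorm (F x0 - y)], and the right side is less than d. *)
have near_y : \forall y \near F x0, sqnorm (F x0 - y) < d / 4.
  have : {for F x0, continuous (fun y : 'rV[R]_m => sqnorm (F x0 - y))}.
    apply: continuous_comp; last exact: continuous_sqnorm.
    exact: cvgB (cvg_cst _) cvg_id.
  move=> /cvgrPdist_lt /(_ (d / 4)); rewrite divr_gt0 // => /(_ isT).
  apply: filterS => y; rewrite subrr.
  have -> : sqnorm (0 : 'rV[R]_m) = 0.
    by rewrite /sqnorm big1 // => i _; rewrite mxE expr0n.
  by rewrite sub0r normrN ger0_norm // sqnorm_ge0.
apply: filterS near_y => y yd.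
have B0 : B !=set0 by exists x0; rewrite /B /= subrr normr0 ltW.
have [c Bc cmin] := EVT_min_rV B0 cB (cN y B rW).
have {}Bc := set_mem Bc.
have cx0 : sqnorm (F c - y) <= sqnorm (F x0 - y).
  by apply: cmin; apply: mem_set; rewrite /B /= subrr normr0 ltW.
have cr : `|c - x0| < r.
  rewrite lt_neqAle Bc andbT; apply/eqP => Sc.
  have := dS c Sc; rewrite -(subrK y (F c)) -addrA => /le_trans /(_ (sqnormD _ _)).
  rewrite -[y - _]opprB sqnormN; lra.
exists c; first exact: rW.
apply: sqnorm_local_min; first exact/surjF/rW.
have : \forall x \near c, `|x - x0| < r.
  have : {for c, continuous (fun x : 'rV[R]_n => `|x - x0|)}.
    apply: continuous_comp; last exact: norm_continuous.
    exact: cvgB cvg_id (cvg_cst _).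
  by move=> /(_ [set s | s < r]); apply; exact: lt_nbhsl.
apply: filterS => x /ltW xr; split; first exact/dF/rW.
by apply: cmin; exact: mem_set.
Qed.

End Openness.

(** * Inverse functions *)

Section InverseFunction.
Variables (R : realType) (n : nat).
Implicit Types (F H : 'rV[R]_n -> 'rV[R]_n) (W : set 'rV[R]_n).

Lemma jacobian_unit F x : (forall w, exists v, 'd F x v = w) ->
  jacobian F x \in unitmx.
Proof.
move=> surj; rewrite -row_full_unit -sub1mx; apply/row_subP => i.
have [v <-] := surj (row i 1%:M); apply/submxP; exists v.
by rewrite /jacobian mul_rV_lin1.
Qed.

(** Put h = [H (k + F x) - x], which tends to 0 with k by continuity of H. Differentiability of F
    makes [k - 'd F x h] small against h. Applying the inverse Jacobian, [h - k *m invmx J] is small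
    against h; hence h is of the order of k, and the error is small against k. *)
Lemma is_diff_inverse F H x : differentiable F x -> jacobian F x \in unitmx ->
  H (F x) = x -> {for F x, continuous H} ->
  (\forall y \near F x, F (H y) = y) ->
  is_diff (F x) H (mulmxr (invmx (jacobian F x))).
Proof.
move=> dF uJ HF cH FH; set J := jacobian F x in uJ *.
have cL := @continuous_linear_rV R n _ (mulmxr (invmx J)).
apply: is_diff_eps => // e e0.
have [K K0 LK] := linear_lipschitz cL.
(* K is a Lipschitz constant of the inverse Jacobian. The first bound gives [K * e1 <= 2^-1], so
   that the term in |h| is absorbed and |h| <= 2 K |k|; the second makes the final error
   [2 * K ^+ 2 * e1 * |k|] at most e |k|. *)
pose e1 := Num.min (2 * K)^-1 (e / (2 * K ^+ 2)).
have K2 : 0 < K ^+ 2 by rewrite exprn_gt0.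
have e10 : 0 < e1.
  by rewrite lt_min invr_gt0 mulr_gt0 //= divr_gt0 // mulr_gt0.
have c1 : {for 0, continuous (fun k : 'rV[R]_n => H (k + F x))}.
  apply: (@continuous_comp _ _ _ (fun k : 'rV[R]_n => k + F x) H).
    exact: cvgD cvg_id (cvg_cst _).
  by rewrite add0r.
have cH0 : {for 0, continuous (fun k : 'rV[R]_n => H (k + F x) - x)}.
  exact: cvgB c1 (cvg_cst _).
have ncH := diff_eps dF e10.
have {}ncH : \forall k \near (0 : 'rV[R]_n), let h := H (k + F x) - x in
    `|F (h + x) - F x - 'd F x h| <= e1 * `|h|.
  by have := cH0; rewrite /prop_for /continuous_at add0r HF subrr => /(_ _ ncH).
have {}FH : \forall k \near (0 : 'rV[R]_n), F (H (k + F x)) = k + F x.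
  by move: FH; rewrite (near_shift 0) /=; under [X in X -> _]eq_near do rewrite /= subr0.
apply: filterS2 ncH FH => k /=; rewrite subrK => + FHk.
rewrite FHk addrK; set h := H (k + F x) - x => kh.
have hE : h - k *m invmx J = - ((k - 'd F x h) *m invmx J).
  by rewrite mulmxBl -(mul_rV_lin1 ('d F x)) -/J mulmxK // opprB.
have b1 : `|h - k *m invmx J| <= K * (e1 * `|h|).
  rewrite hE normrN; apply: le_trans (LK _) _.
  by rewrite ler_pM2l.
have b2 : K * e1 <= 2^-1.
  have -> : 2^-1 = K * (2 * K)^-1 by rewrite invfM mulrCA divff ?mulr1 // gt_eqF.
  by rewrite ler_pM2l // ge_min lexx.
have b3 : 2 * K ^+ 2 * e1 <= e.
  by rewrite mulrC -ler_pdivlMr ?mulr_gt0 // ge_min lexx orbT.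
have b4 : `|h| <= 2 * K * `|k|.
  have : `|h| <= `|h - k *m invmx J| + `|k *m invmx J|.
    by rewrite -{1}(subrK (k *m invmx J) h) ler_normD.
  have := LK k; rewrite /= => Lk hk.
  have : K * (e1 * `|h|) <= 2^-1 * `|h| by rewrite mulrA ler_wpM2r.
  lra.
rewrite HF /= -/h; apply: le_trans b1 _.
have : K * (e1 * `|h|) <= K * (e1 * (2 * K * `|k|)).
  by rewrite ler_pM2l // ler_pM2l.
move=> /le_trans; apply.
have -> : K * (e1 * (2 * K * `|k|)) = (2 * K ^+ 2 * e1) * `|k| by ring.
by rewrite ler_wpM2r.
Qed.

(** By [open_image] F is open on W, so H is continuous, and [is_diff_inverse] gives its
    differential, the inverse Jacobian of F at [H y]. The entries of the latter are smooth functions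
    composed with H, so that H of class C^k is of class C^(k+1). *)
Lemma Cinfty_inverse W F H : open W -> Cinfty W F ->
  (forall x, W x -> H (F x) = x) ->
  (forall x, W x -> forall w, exists v, 'd F x v = w) ->
  Cinfty (F @` W) H.
Proof.
move=> oW cF HF surjF.
have dF x : W x -> differentiable F x by have [] := cF 1; move=> + _; apply.
have oimF (U : set 'rV[R]_n) : open U -> U `<=` W -> open (F @` U).
  move=> oU UW; apply: open_image => //.
  - by move=> x /UW; exact: dF.
  - by move=> x y /UW Wx /UW Wy Fxy; rewrite -(HF x) // Fxy HF.
  - by move=> x /UW; exact: surjF.
have oFW := oimF W oW (@subset_refl _ W).
have cH y : (F @` W) y -> {for y, continuous H}.
  move=> [x Wx <-] B; rewrite HF // nbhsE => -[U [oU Ux] UB].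
  have oUW : open (U `&` W) by exact: openI.
  have : nbhs (F x) (F @` (U `&` W)).
    by apply: open_nbhs_nbhs; split; [exact: oimF|exists x].
  by apply: filterS => _ [z [Uz Wz] <-] /=; rewrite HF //; exact: UB.
have dH y : (F @` W) y -> is_diff y H (mulmxr (invmx (jacobian F (H y)))).
  move=> FWy; have [x Wx <-] := FWy; rewrite HF //.
  apply: is_diff_inverse; first exact: dF.
  - by apply: jacobian_unit; exact: surjF.
  - exact: HF.
  - by apply: cH; exists x.
  - have : nbhs (F x) (F @` W) by apply: open_nbhs_nbhs; split=> //; exists x.
    by apply: filterS => _ [z Wz <-]; rewrite HF.
have WH y : (F @` W) y -> W (H y) by move=> [x Wx <-]; rewrite HF.
elim=> [|k IH]; first exact: cH.
split=> [y /dH[] //|v].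
apply/Ck_coordP => // j.
apply: (@sCk_eq _ _ _ _ (fun y => \sum_(i < n)
   (v 0 i * invmx (jacobian F (H y)) i j))) => // [y FWy|].
  have [dHy dHE] := dH y FWy.
  by rewrite deriveE // dHE /= mxE.
apply: sCk_sum => // i; apply: sCkM => //; first exact: sCk_cst.
apply: sCk_invmx => // [y /WH /surjF|a b]; first exact: jacobian_unit.
have [_ /(_ 'e_a) ca] := cF k.+1.
apply: sCk_eq (sCk_comp oFW WH IH ((Ck_coordP _ _ oW).1 ca b)) => // y /WH /dF dy.
by rewrite /= /jacobian mxE deriveE.
Qed.

End InverseFunction.

(** The dimensions of two smooth spaces are equal only propositionally; the transport along this
    equality is done here once. *)
Lemma Cinfty_inverse_dim (R : realType) (n m : nat) (W : set 'rV[R]_n)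
    (F : 'rV[R]_n -> 'rV[R]_m) (H : 'rV[R]_m -> 'rV[R]_n) :
  n = m -> open W -> Cinfty W F ->
  (forall x, W x -> H (F x) = x) ->
  (forall x, W x -> forall w, exists v, 'd F x v = w) ->
  Cinfty (F @` W) H.
Proof. by move=> nm; case: m / nm F H => F H; exact: Cinfty_inverse. Qed.

(** * Smooth spaces *)

Section SmoothSpaces.
Variables (R : realType).
Implicit Types (X Y Z : smooth_space R).

(** The part of a smooth structure on which the calculus of smooth maps below rests; it is checked
    directly for the local models. *)
Definition charted X : Prop :=
  (forall c, atlas (s := X) c -> is_chart c) /\
  (forall x : X, exists2 c, atlas (s := X) c & chart_dom c x).

Lemma smooth_structure_charted X : has_smooth_structure X -> charted X.
Proof. by case. Qed.

Lemma open_preimage_on (S T : topologicalType) (A : set S) (f : S -> T) (B : set T) :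
  open A -> {in A, continuous f} -> open B -> open (A `&` f @^-1` B).
Proof.
move=> oA cf oB; rewrite openE => x [Ax Bfx]; apply: filterI.
  exact: open_nbhs_nbhs.
by apply: (cf x (mem_set Ax)); exact: open_nbhs_nbhs.
Qed.

Lemma open_rep_dom X Y (A : set X) (f : X -> Y) c d : open A ->
  {in A, continuous f} -> open (chart_dom c) -> open (chart_dom d) ->
  open (rep_dom A f c d).
Proof.
by move=> oA cf oc od; rewrite /rep_dom -setIA; apply/openI/open_preimage_on.
Qed.

Lemma open_chart_image X (c : chart R X (mdim X)) (U : set X) : is_chart c -> open U ->
  U `<=` chart_dom c -> open (c @` U).
Proof. by case=> _ _ _; apply. Qed.

(** A single coordinate expression per pair of charts is defined by choice, consistently because c
    is injective, with junk value 0 elsewhere. Near each point it agrees with a given local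
    expression, and [Ck_local] applies. *)
Lemma smooth_on_local X Y (A : set X) (f : X -> Y) : charted X ->
  {in A, continuous f} ->
  (forall c d x, atlas (s := X) c -> atlas (s := Y) d -> rep_dom A f c d x ->
    exists U tau, [/\ open U, U x, U `<=` rep_dom A f c d,
      Cinfty (c @` U) tau & forall y, U y -> tau (c y) = d (f y)]) ->
  smooth_on A f.
Proof.
move=> [isX _] cf H; split=> // c d ac ad.
have [oc _ injc _] := isX c ac.
have : forall p, exists q, forall x, rep_dom A f c d x -> c x = p -> q = d (f x).
  move=> p; have [[x [dx cx]]|N] := pselect (exists x, rep_dom A f c d x /\ c x = p).
    exists (d (f x)) => y dy cy; congr (d (f _)).
    by apply: injc; [exact/mem_set/dx.1.1|exact/mem_set/dy.1.1|rewrite cx cy].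
  by exists 0 => x dx cx; absurd: N; exists x.
move=> /choice[tau tauE]; exists tau; split; last by move=> x /set_mem dx; exact: tauE.
move=> k; apply: Ck_local => _ [x dx <-].
have [U [rho [oU Ux UA cr re]]] := H c d x ac ad dx.
exists (c @` U); first by exists x.
apply: Ck_eq (cr k).
  by apply: open_chart_image => //; [exact: isX|move=> y /UA[[]]].
by move=> _ [y Uy <-]; rewrite re //; apply/esym/tauE => //; exact: UA.
Qed.

Lemma smooth_on_sub X Y (A B : set X) (f : X -> Y) : B `<=` A ->
  smooth_on A f -> smooth_on B f.
Proof.
move=> BA [cf sf]; split=> [x /set_mem/BA/mem_set|c d ac ad]; first exact: cf.
have BAr : rep_dom B f c d `<=` rep_dom A f c d by move=> x [[cx /BA Ax] dx].
have [tau [ct te]] := sf c d ac ad; exists tau; split=> [k|x /set_mem/BAr/mem_set].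
  by apply: Ck_sub (ct k); exact: image_subset.
exact: te.
Qed.

Lemma smooth_on_continuous X Y (A : set X) (f : X -> Y) x :
  smooth_on A f -> A x -> {for x, continuous f}.
Proof. by move=> [cf _] Ax; apply: cf; exact: mem_set. Qed.

(** Near x the coordinate expression factors through a chart of Y at [f x]. *)
Lemma smooth_on_comp X Y Z (A : set X) (B : set Y) (f : X -> Y) (g : Y -> Z) :
  charted X -> charted Y -> charted Z -> open A -> open B ->
  set_fun A B f -> smooth_on A f -> smooth_on B g -> smooth_on A (g \o f).
Proof.
move=> cX cY cZ oA oB AB sf sg.
have cgf : {in A, continuous (g \o f)}.
  move=> x /set_mem Ax; apply: continuous_comp.
    exact: smooth_on_continuous sf Ax.
  by apply: smooth_on_continuous sg _; exact: AB.
apply: smooth_on_local => // c e x ac ae dx.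
have [d ad dfx] := cY.2 (f x).
have [ic id ie] := And3 (cX.1 c ac) (cY.1 d ad) (cZ.1 e ae).
have [oc od oe] : [/\ open (chart_dom c), open (chart_dom d) & open (chart_dom e)].
  by case: ic; case: id; case: ie.
have [tau1 [c1 e1]] := sf.2 c d ac ad.
have [tau2 [c2 e2]] := sg.2 d e ad ae.
pose U := rep_dom A (g \o f) c e `&` rep_dom A f c d.
have oU : open U by apply: openI; apply: open_rep_dom => //; exact: sf.1.
have Ud y : U y -> rep_dom B g d e (f y).
  by move=> [[[_ Ay] ey] [_ dy]]; split=> //; split=> //; exact: AB.
exists U, (tau2 \o tau1); split=> //.
- by split=> //; case: dx => -[].
- exact: subIsetl.
- move=> k; apply: (@Ck_comp _ _ _ _ _ _ (d @` rep_dom B g d e)).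
  + by apply: open_chart_image => // y [[[]]].
  + apply: open_chart_image => //; last by move=> y [[]].
    by apply: open_rep_dom => //; exact: sg.1.
  + move=> _ [y Uy <-]; rewrite e1; last exact/mem_set/Uy.2.
    by exists (f y) => //; exact: Ud.
  + by apply: Ck_sub (c1 k); apply: image_subset; exact: subIsetr.
  + exact: c2.
- move=> y Uy /=; rewrite e1 ?e2 //; last exact/mem_set/Uy.2.
  exact/mem_set/Ud.
Qed.

Lemma inverse_diffeos_sym X Y (A : set X) (B : set Y) f g :
  inverse_diffeos A B f g -> inverse_diffeos B A g f.
Proof. by case=> -[? ?] [? ?] [? ?] ? ?. Qed.

Lemma inverse_diffeos_comp X Y Z (A : set X) (B B' : set Y) (C : set Z) f g f' g' :
  charted X -> charted Y -> charted Z ->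
  inverse_diffeos A B f g -> inverse_diffeos B' C f' g' ->
  inverse_diffeos (A `&` f @^-1` B') (C `&` g' @^-1` B) (f' \o f) (g \o g').
Proof.
move=> cX cY cZ [[oA oB] [AB BA] [fK gK] sf sg] [[oB' oC] [B'C CB'] [f'K g'K] sf' sg'].
have oA' : open (A `&` f @^-1` B') by apply: open_preimage_on => //; exact: sf.1.
have oC' : open (C `&` g' @^-1` B) by apply: open_preimage_on => //; exact: sg'.1.
split=> //.
- split=> [x [Ax B'x]|z [Cz Bz]]; split=> /=.
  + exact: B'C.
  + by rewrite f'K ?inE //; exact: AB.
  + exact: BA.
  + by rewrite gK ?inE //; exact: CB'.
- split=> [x /set_mem[Ax B'x]|z /set_mem[Cz Bz]] /=.
  + by rewrite f'K ?fK ?inE.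
  + by rewrite gK ?g'K ?inE.
- apply: (@smooth_on_comp _ _ _ _ B') => //; first by move=> x [].
  exact: smooth_on_sub sf.
- apply: (@smooth_on_comp _ _ _ _ B) => //; first by move=> x [].
  exact: smooth_on_sub sg'.
Qed.

(** By the chain rule the n x m Jacobian of F times the m x n Jacobian of H is the identity, which
    bounds n by the rank m. *)
Lemma left_inverse_dim (n m : nat) (F : 'rV[R]_n -> 'rV[R]_m)
    (H : 'rV[R]_m -> 'rV[R]_n) p :
  differentiable F p -> differentiable H (F p) ->
  (\forall q \near p, H (F q) = q) -> (n <= m)%N.
Proof.
move=> dF dH HF.
have J1 : jacobian F p *m jacobian H (F p) = 1%:M.
  have dHF := differentiable_comp dF dH.
  apply/row_matrixP => i; rewrite row_mul rowE -mulmxA.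
  rewrite mulmxA /jacobian !mul_rV_lin1 -[LHS]/(('d H (F p) \o 'd F p) 'e_i).
  rewrite -(diff_comp dF dH) -(deriveE _ dHF).
  have -> : 'D_('e_i) (H \o F) p = 'D_('e_i) id p by exact: near_eq_derive.
  by rewrite derive_id rowE mulmx1.
by have := mulmx1_min J1.
Qed.

Lemma diffeo_dim_le X Y (A : set X) (B : set Y) f g x :
  charted X -> charted Y -> inverse_diffeos A B f g -> A x ->
  (mdim X <= mdim Y)%N.
Proof.
move=> cX cY [[oA oB] [AB BA] [fK gK] sf sg] Ax.
have [c ac cx] := cX.2 x; have [d ad dx] := cY.2 (f x).
have [oc od] : open (chart_dom c) /\ open (chart_dom d).
  by case: (cX.1 c ac); case: (cY.1 d ad).
have [tau1 [c1 e1]] := sf.2 c d ac ad.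
have [tau2 [c2 e2]] := sg.2 d c ad ac.
have gfx : g (f x) = x by rewrite fK ?inE.
have xr : rep_dom A f c d x by split.
have back y : rep_dom A f c d y -> rep_dom B g d c (f y).
  by move=> [[cy Ay] dy]; do !split=> //; [exact: AB|rewrite /preimage /= fK ?inE].
apply: (@left_inverse_dim _ _ tau1 tau2 (c x)).
- by apply: (c1 1).1; exists x.
- apply: (c2 1).1; rewrite e1 ?inE //; exists (f x) => //; exact: back.
- have : open (c @` rep_dom A f c d).
    apply: (open_chart_image (cX.1 c ac)); last by move=> y [[]].
    by apply: open_rep_dom => //; exact: sf.1.
  move=> oi; have : nbhs (c x) (c @` rep_dom A f c d).
    by apply: open_nbhs_nbhs; split=> //; exists x.
  apply: filterS => _ [y yr <-].
  rewrite e1 ?inE // e2; last exact/mem_set/back.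
  by rewrite fK // inE; case: yr => -[].
Qed.

Lemma diffeo_dim X Y (A : set X) (B : set Y) f x :
  charted X -> charted Y -> diffeo_on A B f -> A x -> mdim X = mdim Y.
Proof.
move=> cX cY [g fg] Ax; apply/eqP; rewrite eqn_leq.
rewrite (diffeo_dim_le cX cY fg Ax) /=.
apply: (diffeo_dim_le cY cX (inverse_diffeos_sym fg) (x := f x)).
by case: fg => _ [+ _] _ _ _; exact.
Qed.

(** In charts, [open_image] shows that f is open on A, hence that g is continuous, and
    [Cinfty_inverse_dim] that g is smooth. *)
Lemma injective_submersion_inverse X Y (A : set X) (f : X -> Y) (g : Y -> X) :
  charted X -> charted Y -> mdim X = mdim Y -> submersion f ->
  open A -> (forall x, A x -> g (f x) = x) ->
  inverse_diffeos A (f @` A) f g.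
Proof.
move=> cX cY dimXY [sf subf] oA gf.
have sfA : smooth_on A f by exact: smooth_on_sub sf.
(* Used twice: on a small neighbourhood of a point for the openness of f, and on a whole [rep_dom]
   for the smoothness of g. *)
have loc c d (ac : atlas (s := X) c) (ad : atlas (s := Y) d) (U : set X) :
    open U -> U `<=` A -> U `<=` chart_dom c -> U `<=` f @^-1` chart_dom d ->
    exists tau, [/\ Cinfty (c @` U) tau, (forall x, U x -> tau (c x) = d (f x)),
      open (c @` U), (forall x y, U x -> U y -> tau (c x) = tau (c y) -> x = y) &
      forall x, U x -> forall w, exists v, 'd tau (c x) v = w].
  move=> oU UA Uc Ud; have [tau rtau] := sf.2 c d ac ad; have [ct te] := rtau.
  have Ur : U `<=` rep_dom setT f c d by move=> x Ux; do !split; [exact: Uc|exact: Ud].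
  have te' x : U x -> tau (c x) = d (f x) by move=> Ux; apply: te; exact/mem_set/Ur.
  exists tau; split=> //.
  - by move=> k; apply: Ck_sub (ct k); exact: image_subset.
  - exact: open_chart_image (cX.1 c ac) oU Uc.
  - move=> x y Ux Uy; rewrite !te' // => dd.
    rewrite -(gf x (UA x Ux)) -[RHS](gf y (UA y Uy)); congr g.
    have [_ _ injd _] := cY.1 d ad.
    by apply: injd => //; apply: mem_set; [exact: Ud|exact: Ud].
  - by move=> x Ux; apply: subf rtau => //; [exact: Uc|exact: Ud].
have oim (U : set X) : open U -> U `<=` A -> open (f @` U).
  move=> oU UA; rewrite openE => _ [x Ux <-].
  have [c ac cx] := cX.2 x; have [d ad dx] := cY.2 (f x).
  have [oc _ _ _] := cX.1 c ac; have [od cd injd _] := cY.1 d ad.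
  pose U' := U `&` (chart_dom c `&` (setT `&` f @^-1` chart_dom d)).
  have oU' : open U'.
    apply: openI => //; apply: openI => //.
    by apply: open_preimage_on => //; [exact: openT|exact: sf.1].
  have [|||tau [ct te oc' inj surj]] := loc c d ac ad U' oU'.
  - by move=> y [/UA].
  - by move=> y [_ []].
  - by move=> y [_ [_ []]].
  have oW : open (tau @` (c @` U')).
    apply: open_image => //.
    + by move=> p pU; exact: (ct 1).1.
    + by move=> _ _ [y Uy <-] [z Uz <-] /(inj _ _ Uy Uz) ->.
    + by move=> _ [y Uy <-]; exact: surj.
  have : nbhs (f x) (chart_dom d `&` d @^-1` (tau @` (c @` U'))).
    apply: open_nbhs_nbhs; split; first exact: open_preimage_on.
    by split=> //; exists (c x); [exists x|rewrite te].
  apply: filterS => z [dz [_ [y Uy <-]]]; rewrite te // => ddz.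
  exists y; first by case: Uy.
  by apply: injd; rewrite ?inE //; case: Uy => _ [_ []].
split=> //.
- by split=> //; exact: oim.
- by split=> [x Ax|_ [x Ax <-]]; [exists x|rewrite gf].
- split=> [x /set_mem Ax|_ /set_mem[x Ax <-]]; first exact: gf.
  by rewrite gf.
split=> [_ /set_mem[x Ax <-] B|d c ad ac].
  rewrite gf // nbhsE => -[U [oU Ux] UB].
  have : nbhs (f x) (f @` (U `&` A)).
    apply: open_nbhs_nbhs; split; last by exists x.
    by apply: oim; [exact: openI|exact: subIsetr].
  by apply: filterS => _ [y [Uy Ay] <-] /=; rewrite gf //; exact: UB.
have [oc _ _ _] := cX.1 c ac; have [od _ injd _] := cY.1 d ad.
pose U := rep_dom A f c d.
have oU : open U by apply: open_rep_dom => //; exact: sfA.1.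
have [|||tau [ct te oc' inj surj]] := loc c d ac ad U oU.
- by move=> y [[]].
- by move=> y [[]].
- by move=> y [].
(* The coordinate expression of g, with junk value 0 off the image of tau. *)
pose H := 'pinv_(fun=> 0) (c @` U) tau.
have HE p : (c @` U) p -> H (tau p) = p.
  move=> pU; apply: pinvKV; last exact: mem_set.
  move=> _ _ /set_mem[y Uy <-] /set_mem[z Uz <-] yz.
  by rewrite (inj _ _ Uy Uz yz).
have dE z : rep_dom (f @` A) g d c z -> exists2 x, U x & z = f x.
  move=> [[dz [x Ax fx]] cz]; exists x => //; move: cz dz.
  by rewrite -fx /preimage /= gf // => cx dx.
exists H; split=> [|z /set_mem /dE[x Ux ->]]; last first.
  rewrite -(te x Ux) HE; last by exists x.
  by rewrite gf //; case: Ux => -[].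
have CH : Cinfty (tau @` (c @` U)) H.
  by apply: Cinfty_inverse_dim => // _ [x Ux <-]; exact: surj.
move=> k; apply: Ck_sub (CH k) => _ [z /dE[x Ux ->] <-].
by exists (c x); [exists x|rewrite te].
Qed.

End SmoothSpaces.

(** * Charts of the local models *)

Section ModelCharts.
Variables (R : realType).

(** In each model the generating charts share one coordinate map, so the identity serves as every
    change of coordinates. *)
Lemma smooth_change_id (T : Type) (n : nat) (c d : chart R T n) :
  (forall x, c x = d x) -> smooth_change c d.
Proof.
by move=> cd; exists id; split=> [k|x _]; [exact: Ck_id|exact: cd].
Qed.

Lemma id_chart_atlas (n : nat) :
  atlas (s := cartesian_space R n) (Chart setT id).
Proof.
split=> [|_ ->]; last by split; exact: smooth_change_id.
split=> [|x _|x y _ _|U oU _] //=; first exact: openT.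
by have -> : [set x | x in U] = U by exact: image_id.
Qed.

Lemma charted_cartesian (n : nat) : charted (cartesian_space R n).
Proof.
split=> [c []|x] //; exists (Chart setT id) => //.
exact: id_chart_atlas.
Qed.

Variables (n : nat) (Gamma : groupType).

Lemma open_sheet (g : Gamma) :
  open [set z : discrete_topology Gamma * 'rV[R]_n | z.1 = g].
Proof.
have -> : [set z : discrete_topology Gamma * 'rV[R]_n | z.1 = g] =
    fst @^-1` [set (g : discrete_topology Gamma)] by [].
apply: open_comp => [z _|]; first exact: cvg_fst.
exact: discrete_open.
Qed.

Lemma is_chart_sheet (g : Gamma) :
  @is_chart R (discrete_topology Gamma * 'rV[R]_n)%type n
    (Chart [set z | z.1 = g] snd).
Proof.
split=> /=; first exact: open_sheet.
- by move=> z _; exact: cvg_snd.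
- by move=> [a x] [b y] /set_mem /= -> /set_mem /= -> ->.
- move=> U oU Ug; rewrite openE => _ [[a x] Uax <-] /=.
  have := open_nbhs_nbhs (conj oU Uax); move=> [[P Q] [Pa Qx] PQ].
  apply: filterS Qx => y Qy; exists (a, y) => //; apply: PQ; split=> //=.
  exact: nbhs_singleton Pa.
Qed.

Lemma charted_action_arr : charted (action_arr R n Gamma).
Proof.
split=> [c []|[g x]] //; exists (Chart [set z | z.1 = g] snd) => //.
split=> [|d [h ->]]; first exact: is_chart_sheet.
by split; exact: smooth_change_id.
Qed.

End ModelCharts.

(** * Countable families of affine maps *)

Section CountableImages.
Variables (R : realType).

(** A countable set has Lebesgue measure 0, and the interval has measure b - a. *)
Lemma uncountable_itv (a b : R) : a < b -> ~ countable `]a, b[%classic.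
Proof.
move=> ab /countable_lebesgue_measure0; rewrite lebesgue_measure_itv /= lte_fin ab.
by move=> /eqP; rewrite -EFinB eqe subr_eq0 gt_eqF.
Qed.

Lemma subset_countable (T : Type) (A B : set T) : A `<=` B -> countable B -> countable A.
Proof. by move=> AB; apply: sub_countable; exact: subset_card_le. Qed.

(** If u took two values, its image would contain the interval between them by the intermediate
    value theorem. *)
Lemma countable_image_constant (a b : R) (u : R -> R) :
  (forall t, t \in `]a, b[%R -> {for t, continuous u}) ->
  countable (u @` `]a, b[%classic) ->
  forall s t, s \in `]a, b[%R -> t \in `]a, b[%R -> u s = u t.
Proof.
move=> cu count s t.
wlog st : s t / s <= t.
  by move=> H sI tI; have [/H|/ltW/H] := leP s t; [apply|move=> E; apply/esym/E].
move=> sI tI; apply/eqP; apply: contraT => ust.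
have mM : Num.min (u s) (u t) < Num.max (u s) (u t).
  by case: (ltgtP (u s) (u t)) ust.
have stI x : x \in `[s, t]%R -> x \in `]a, b[%R.
  move: sI tI; rewrite !in_itv /= => /andP[As sb] /andP[At tb] /andP[sx xt].
  by rewrite (lt_le_trans As sx) (le_lt_trans xt tb).
absurd: (uncountable_itv mM); apply: subset_countable count => y /=.
rewrite in_itv /= => /andP[/ltW my /ltW yM].
have cst : {within `[s, t], continuous u}.
  by apply: continuous_in_subspaceT => x /set_mem xI; apply: cu; exact: stI.
have [|x xI <-] := @IVT _ u s t y st cst; first by rewrite my.
by exists x => //; exact: stI.
Qed.

(* At a limit point of the coincidence set of two functions their derivatives
   agree, and a subset of the line has at most countably many isolated points:
   so the derivative below has countable image. *)
Lemma derive_locally_affine_constant (T : Type) (p q : T -> R) (a b : R) (u : R -> R) :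
  countable [set: T] ->
  (forall t, t \in `]a, b[%R -> derivable u t 1) ->
  (forall t, t \in `]a, b[%R -> {for t, continuous ('D_1 u)}) ->
  (forall t, t \in `]a, b[%R -> exists g, u t = p g + q g * t) ->
  forall s t, s \in `]a, b[%R -> t \in `]a, b[%R -> 'D_1 u s = 'D_1 u t.
Proof.
move=> cT du cdu upq; apply: countable_image_constant => //.
pose C g := [set t : R | t \in `]a, b[%R /\ u t = p g + q g * t].
pose E := \bigcup_(g in [set: T]) isolated (C g).
have cE : countable E.
  by apply: bigcup_countable => // g _; exact: countable_isolated.
(* The possible values of the derivative: slopes [q g] (index true, at limit points) and values on
   the countable set E (index false, at isolated points). *)
have cqE : countable (\bigcup_(i in [set: bool])
    if i then q @` [set: T] else 'D_1 u @` E).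
  apply: bigcup_countable => [|[] _]; first exact: finite_set_countable.
    exact: sub_countable (card_image_le _ _) cT.
  exact: sub_countable (card_image_le _ _) cE.
apply: subset_countable cqE => _ [t tI <-].
have [g ut] := upq t tI.
have : closure (C g) t by apply: subset_closure; split.
rewrite closure_isolated_limit_point => -[tiso|tlim].
  by exists false => //=; exists t => //; exists g.
exists true => //=; exists g => //.
apply/eqP; rewrite eq_sym -subr_eq0; apply: contraT => ne0.
(* w vanishes on [C g]. With a nonzero derivative at t, it would be nonzero at all points near t
   other than t, but t is a limit point of [C g]. *)
pose w (s : R) := u s - (p g + q g * s).
have dw : is_derive t 1 w ('D_1 u t - q g).
  have -> : w = u - (cst (p g) + q g *: id) by apply/funext.
  have -> : 'D_1 u t - q g = 'D_1 u t - (0 + q g *: (1 : R)).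
    by rewrite add0r -[_ *: 1]/(q g * 1) mulr1.
  exact: is_deriveB (derivableP (du t tI))
    (is_deriveD (is_derive_cst (p g) t 1) (is_deriveZ (q g) (is_derive_id t 1))).
have [dvw ew] := dw.
have : (fun h : R => h^-1 *: (w (h *: 1 + t) - w t)) @ 0^' --> 'D_1 w t by exact: dvw.
rewrite ew => /cvgr_neq0 /(_ ne0).
move=> H; have {}H : \forall h \near (0 : R), h != 0 ->
  h^-1 *: (w (h *: 1 + t) - w t) != 0 by exact: H.
move: H; rewrite (near_shift t) /= => /tlim[y [yt [yI uy]]].
rewrite /= sub0r subr_eq0 => /(_ yt) /eqP; case.
rewrite /w -[_ *: 1]/((y - t) * 1) mulr1 subrK uy ut !subrr.
by rewrite scaler0.
Qed.

Lemma poly_roots_countable (p : {poly R}) : p != 0 -> countable [set x | root p x].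
Proof.
move=> p0; apply: finite_set_countable; apply: contrapT.
move=> /(infinite_set_fset (size p))[B BA]; apply/negP; rewrite -ltnNge.
apply: (@max_poly_roots _ p _ p0); last exact: finmap.fset_uniq.
by apply/allP => x xB; exact: BA.
Qed.

End CountableImages.

(** * Maps agreeing pointwise with countably many affine maps *)

Section AffineFamily.
Variables (R : realType) (n : nat) (T : Type).
Variables (A : T -> 'M[R]_n) (b : T -> 'rV[R]_n).
Hypothesis countableT : countable [set: T].
Variables (F : 'rV[R]_n -> 'rV[R]_n) (x0 : 'rV[R]_n) (r : R).
Hypothesis CF : Ck 1 [set x | `|x - x0| < r] F.
Hypothesis FA : forall x, `|x - x0| < r -> exists g, F x = x *m A g + b g.

(** Along the line through x0 in direction v, [derive_locally_affine_constant] makes the derivative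
    of each coordinate of F constant, and the mean value theorem on [0, 1] gives the formula. *)
Lemma affine_on_lines v : `|v| < r / 2 -> F (v + x0) = F x0 + 'd F x0 v.
Proof.
move=> vr; have r0 : 0 < r by have := normr_ge0 v; lra.
have [dF cF] := CF.
(* Halving the radius leaves room for an open interval of parameters around [0, 1]. *)
have line (t : R) : t \in `]-2, 2[%R -> `|t *: v + x0 - x0| < r.
  rewrite in_itv /= => /andP[t1 t2]; rewrite addrK normrZ.
  have : `|t| <= 2 by rewrite ler_norml !ltW.
  by move=> /(ler_wpM2r (normr_ge0 v)) /le_lt_trans; apply; lra.
have dFx0 : differentiable F x0 by apply: dF; rewrite /= subrr normr0.
apply/rowP => i; pose u (t : R) := F (t *: v + x0) 0 i.
have du (t : R) : t \in `]-2, 2[%R -> is_derive t 1 u ('D_v F (t *: v + x0) 0 i).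
  move=> /line /dF dFt; rewrite derive_coord //.
  exact: is_derive_line ((differentiable_coordP F _).1 dFt i).
have I0 : (0 : R) \in `]-2, 2[%R by rewrite in_itv /= oppr_lt0 ltr0n.
have cst_u := @derive_locally_affine_constant R T
  (fun g => (x0 *m A g + b g) 0 i) (fun g => (v *m A g) 0 i) (-2) 2 u countableT.
have {}cst_u : forall t : R, t \in `]-2, 2[%R -> 'D_1 u t = 'D_1 u 0.
  move=> t tI; apply: cst_u => //.
  - by move=> s /du[].
  - move=> s sI.
    have sI' : \forall z \near s, 'D_v F (z *: v + x0) 0 i = 'D_1 u z.
      have := near_in_itvoo sI.
      by apply: filterS => z /du[_ <-].
    rewrite /prop_for /continuous_at -(nbhs_singleton sI').
    apply: cvg_trans (near_eq_cvg sI') _.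
    apply: (@continuous_comp _ _ _ (fun z : R => z *: v + x0) (fun x => 'D_v F x 0 i)).
      exact: cvgD (cvgZr_tmp cvg_id) (cvg_cst _).
    by apply: (continuous_coordP _ _).1; apply: cF; exact: line.
  - move=> s /line /FA[g Fg]; exists g.
    rewrite /u Fg mulmxDl -scalemxAl -addrA; move: (v *m A g) (x0 *m A g + b g) => P Q.
    by rewrite !mxE addrC mulrC.
have cu : {within `[0, 1], continuous u}.
  apply: continuous_in_subspaceT => t /set_mem /=; rewrite in_itv /= => /andP[t0 t1].
  have [//|+ _] := du t; first by rewrite in_itv /=; apply/andP; split; lra.
  by move=> /derivable1_diffP /differentiable_continuous.
have du1 (t : R) : t \in `]0, 1[%R -> is_derive t 1 u ('D_1 u t).
  rewrite in_itv /= => /andP[t0 t1]; apply: derivableP.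
  by have [] := du t; first by rewrite in_itv /=; apply/andP; split; lra.
have [c] := MVT ltr01 du1 cu.
rewrite in_itv /= => /andP[c0 c1].
rewrite cst_u; last by rewrite in_itv /=; apply/andP; split; lra.
rewrite subr0 mulr1 /u scale1r scale0r add0r => E.
rewrite mxE; apply/eqP; rewrite -subr_eq0 opprD addrA E.
have [_ ->] := du 0 I0.
by rewrite scale0r add0r deriveE // subrr.
Qed.

(* Only one affine map of the family can agree with the affine map F on
   infinitely many points of the moment curve t |-> (t, t^2, ..., t^n). *)
Lemma affine_family_rigid : 0 < r ->
  exists g, forall v, `|v| < r / 2 -> F (v + x0) = (v + x0) *m A g + b g.
Proof.
move=> r0; have [dF _] := CF.
pose J := jacobian F x0.
have FJ v : `|v| < r / 2 -> F (v + x0) = F x0 + v *m J.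
  by move=> /affine_on_lines ->; rewrite /J /jacobian mul_rV_lin1.
pose k g := F x0 - (x0 *m A g + b g); pose D g := J - A g.
(* Coordinate i of the difference, at [c t + x0], between the affine expression of F and the map of
   index g. As the exponents of the curve start at 1, the constant coefficient comes from [k g]
   alone and the others are entries of [D g]. *)
pose P g i := (k g 0 i)%:P + \sum_(j < n) (D g j i) *: 'X^(j.+1).
pose c (t : R) : 'rV[R]_n := \row_j t ^+ j.+1.
have PE g i t : (P g i).[t] = (k g + c t *m D g) 0 i.
  rewrite hornerD hornerC horner_sum [RHS]mxE; congr (_ + _).
  by rewrite mxE; apply: eq_bigr => j _; rewrite hornerZ hornerXn [c t 0 j]mxE mulrC.
have FP g v : F x0 + v *m J = (v + x0) *m A g + b g <-> k g + v *m D g = 0.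
  have -> : k g + v *m D g = (F x0 + v *m J) - ((v + x0) *m A g + b g).
    rewrite /k /D mulmxBr mulmxDl.
    move: (F x0) (x0 *m A g) (b g) (v *m J) (v *m A g) => a1 a2 a3 a4 a5.
    by apply/rowP => i; rewrite !mxE; ring.
  by split=> [->|/subr0_eq //]; rewrite subrr.
have [[g Pg]|N] := pselect (exists g, forall i, P g i = 0).
  have k0 : k g = 0.
    apply/rowP => i; rewrite [RHS]mxE.
    have := congr1 (fun p : {poly R} => p`_0) (Pg i).
    rewrite /= /P coefD coefC eqxx coef0 coef_sum big1 ?addr0 // => j _.
    by rewrite coefZ coefXn mulr0.
  have D0 : D g = 0.
    apply/matrixP => j i; rewrite [RHS]mxE.
    have := congr1 (fun p : {poly R} => p`_(j.+1)) (Pg i).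
    rewrite /= /P coefD coefC /= coef0 coef_sum add0r (bigD1 j) //= big1 => [|l lj].
      by rewrite addr0 coefZ coefXn eqxx mulr1.
    by rewrite coefZ coefXn eqSS [_ == _](negbTE _) ?mulr0 // eq_sym.
  by exists g => v vr; rewrite FJ //; apply/FP; rewrite k0 D0 mulmx0 addr0.
(* For 0 < t < 1 the powers of t are at most t, so the sup norm of [c t] is at most t, which is
   below [r / 2]. *)
pose d : R := Num.min 1 (r / 2).
have d0 : 0 < d by rewrite lt_min ltr01 divr_gt0.
absurd: (uncountable_itv d0).
(* Each g has some nonzero [P g i], so it agrees with F at countably many t only; yet every t in ]0,
   d[ is such a parameter for some g. *)
have cP : countable (\bigcup_(g in [set: T]) [set t | forall i, root (P g i) t]).
  apply: bigcup_countable => // g _.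
  have [i Pi] : exists i, P g i != 0.
    apply: contrapT => Ni; apply: N; exists g => i; apply/eqP.
    by apply: contraT => Pi; case: Ni; exists i.
  by apply: subset_countable (poly_roots_countable Pi) => t; exact.
apply: subset_countable cP => t /=; rewrite in_itv /= => /andP[t0].
rewrite lt_min => /andP[t1 tr].
have ct : `|c t| < r / 2.
  apply: (@le_lt_trans _ _ t) => //; rewrite /Num.Def.normr /= mx_normrE.
  apply: bigmax_le => [|[i j] _]; first exact: ltW.
  rewrite mxE ger0_norm; last exact/exprn_ge0/ltW.
  by rewrite exprS ger_pMr //; apply: exprn_ile1; apply: ltW.
have [|g] := @FA (c t + x0).
  by rewrite addrK; apply: lt_trans ct _; rewrite ltr_pdivrMr // ltr_pMr // ltr1n.
rewrite FJ // => /FP k0; exists g => // i.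
by rewrite /root PE k0 mxE.
Qed.

End AffineFamily.

(** * Quasifold groupoids *)

(** On a line through x0 each coordinate of F is a continuous real function with countable image, so
    [countable_image_constant] applies. *)
Lemma countable_image_ball_constant (R : realType) (k n : nat)
    (F : 'rV[R]_k -> 'rV[R]_n) (x0 : 'rV[R]_k) (r : R) :
  (forall x, `|x - x0| < r -> {for x, continuous F}) ->
  countable (F @` [set x | `|x - x0| < r]) ->
  forall v, `|v| < r / 2 -> F (v + x0) = F x0.
Proof.
move=> cF count v vr.
have line (t : R) : t \in `]-2, 2[%R -> `|t *: v + x0 - x0| < r.
  rewrite in_itv /= => /andP[t1 t2]; rewrite addrK normrZ.
  have : `|t| <= 2 by rewrite ler_norml !ltW.
  by move=> /(ler_wpM2r (normr_ge0 v)) /le_lt_trans; apply; lra.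
apply/rowP => i; pose u (t : R) := F (t *: v + x0) 0 i.
have cu (t : R) : t \in `]-2, 2[%R -> {for t, continuous u}.
  move=> /line tr.
  apply: (@continuous_comp _ _ _ (fun z : R => z *: v + x0) (fun x => F x 0 i)).
    exact: cvgD (cvgZr_tmp cvg_id) (cvg_cst _).
  by apply: (continuous_coordP _ _).1; exact: cF.
have countu : countable (u @` `]-2, 2[%classic).
  have := sub_countable (card_image_le (fun y : 'rV[R]_n => y 0 i) _) count.
  apply: subset_countable => _ [t /line tr <-].
  by exists (F (t *: v + x0)) => //; exists (t *: v + x0).
have := countable_image_constant cu countu (s := 1) (t := 0).
rewrite /u scale1r scale0r add0r; apply; rewrite in_itv /=; apply/andP; split; lra.
Qed.

Lemma smooth_on_Cinfty (R : realType) (n m : nat) (W : set 'rV[R]_n)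
    (F : 'rV[R]_n -> 'rV[R]_m) : open W ->
  @smooth_on R (cartesian_space R n) (cartesian_space R m) W F -> Cinfty W F.
Proof.
move=> oW [_ sF].
have [tau [ct te]] := sF _ _ (id_chart_atlas R n) (id_chart_atlas R m).
have Wr x : W x -> @rep_dom R (cartesian_space R n) (cartesian_space R m) W F
    (Chart setT id) (Chart setT id) x by move=> Wx; do !split.
move=> k; apply: (Ck_eq (F := tau)) => // [x /Wr Wx|]; first exact/te/mem_set.
by apply: Ck_sub (ct k) => x /Wr Wx; exists x.
Qed.

(* The restriction of G to [mdom] in the coordinates [mpsi]: the action
   groupoid of a countable family of affine maps v |-> v A_i + b_i on [mV]. *)
Record affine_model (R : realType) (G : groupoid_data R) := AffineModel {
  mdimn : nat;
  mindex : Type;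
  mmx : mindex -> 'M[R]_mdimn;
  mshift : mindex -> 'rV[R]_mdimn;
  mV : set 'rV[R]_mdimn;
  mdom : set (obj G);
  mphi : 'rV[R]_mdimn -> obj G;
  mpsi : obj G -> 'rV[R]_mdimn;
  marrow : mindex -> 'rV[R]_mdimn -> arr G;
  mact := fun i v => v *m mmx i + mshift i;
  msheet := fun i => [set v | mV v /\ mV (mact i v)];
  mcountable : countable [set: mindex];
  mdiffeo : @inverse_diffeos R (cartesian_space R mdimn) (obj G) mV mdom mphi mpsi;
  marrow_src : forall i v, msheet i v -> src (marrow i v) = mphi v;
  marrow_tgt : forall i v, msheet i v -> tgt (marrow i v) = mphi (mact i v);
  marrow_continuous : forall i v, msheet i v -> {for v, continuous (marrow i)};
  marrow_open : forall i, open (marrow i @` msheet i);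
  marrow_onto : forall g, arrows_over mdom g -> exists i,
    [/\ msheet i (mpsi (src g)), mpsi (tgt g) = mact i (mpsi (src g)) &
        marrow i (mpsi (src g)) = g];
  mdim_obj : mdom !=set0 -> mdim (arr G) = mdim (obj G) }.

Arguments mV {R G} a.
Arguments mphi {R G} a.
Arguments mdim_obj {R G} a.

Section Quasifold.
Variables (R : realType) (G : groupoid_data R).
Hypothesis lieG : is_lie_groupoid G.
Hypothesis models : forall x : obj G,
  exists (n : nat) (Gamma : groupType)
         (a : Gamma -> 'rV[R]_n -> 'rV[R]_n)
         (V : set (obj (action_groupoid a))) (U : set (obj G))
         (phi1 : arr (action_groupoid a) -> arr G)
         (phi0 : obj (action_groupoid a) -> obj G),
    [/\ countable [set: Gamma], affine_action a, open V,
        open_nbhs x U & lie_iso_on V U phi1 phi0].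

Let groupoidG : is_groupoid G. Proof. by case: lieG. Qed.

Lemma charted_obj : charted (obj G).
Proof. by case: lieG => _ [[hs _ _] _] _ _ _; exact: smooth_structure_charted. Qed.

Lemma charted_arr : charted (arr G).
Proof. by case: lieG => _ [_ hs] _ _ _; exact: smooth_structure_charted. Qed.

(** * Groupoid identities *)

Lemma src_unit (x : obj G) : src (unit_arr x) = x.
Proof. by case: groupoidG => /(_ x)[]. Qed.

Lemma tgt_unit (x : obj G) : tgt (unit_arr x) = x.
Proof. by case: groupoidG => /(_ x)[]. Qed.

Lemma src_inv (g : arr G) : src (inv_arr g) = tgt g.
Proof. by case: groupoidG => _ /(_ g)[]. Qed.

Lemma tgt_inv (g : arr G) : tgt (inv_arr g) = src g.
Proof. by case: groupoidG => _ /(_ g)[]. Qed.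

Lemma src_comp (g h : arr G) : src g = tgt h -> src (comp_arr g h) = src h.
Proof. by case: groupoidG => _ _ /(_ g h) H _ _ /H[]. Qed.

Lemma tgt_comp (g h : arr G) : src g = tgt h -> tgt (comp_arr g h) = tgt g.
Proof. by case: groupoidG => _ _ /(_ g h) H _ _ /H[]. Qed.

Lemma comp_assoc (g h k : arr G) : src g = tgt h -> src h = tgt k ->
  comp_arr g (comp_arr h k) = comp_arr (comp_arr g h) k.
Proof. by case: groupoidG => _ _ _ H _; exact: H. Qed.

Lemma comp_unit (g : arr G) : comp_arr g (unit_arr (src g)) = g.
Proof. by case: groupoidG => _ _ _ _ /(_ g)[]. Qed.

Lemma unit_comp (g : arr G) : comp_arr (unit_arr (tgt g)) g = g.
Proof. by case: groupoidG => _ _ _ _ /(_ g)[]. Qed.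

Lemma inv_comp (g : arr G) : comp_arr (inv_arr g) g = unit_arr (src g).
Proof. by case: groupoidG => _ _ _ _ /(_ g)[]. Qed.

Lemma comp_inv (g : arr G) : comp_arr g (inv_arr g) = unit_arr (tgt g).
Proof. by case: groupoidG => _ _ _ _ /(_ g)[]. Qed.

(** Since g = (g h^-1) h. This reduces injectivity of the source near an arrow to injectivity near a
    unit. *)
Lemma eq_of_comp_inv (g h : arr G) : src g = src h ->
  comp_arr g (inv_arr h) = unit_arr (tgt h) -> g = h.
Proof.
move=> gh e; rewrite -(comp_unit g) gh -inv_comp comp_assoc ?src_inv //.
  by rewrite e unit_comp.
by rewrite tgt_inv.
Qed.

Lemma inv_involutive (g : arr G) : inv_arr (inv_arr g) = g.
Proof.
apply: eq_of_comp_inv; first by rewrite src_inv tgt_inv.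
by rewrite inv_comp src_inv.
Qed.

(** The indices are the elements of Gamma, with matrices and shifts chosen for their affine actions,
    and [phi1] transports the sheets of the action groupoid to G. *)
Lemma affine_model_at (x : obj G) : exists c : affine_model G, mdom c x.
Proof.
have [n [Gamma [a [V [U [phi1 [phi0 [cGamma [a1 aM aff] oV [oU Ux]]]]]]]]] := models x.
move=> [[psi0 d0] [psi1 d1] st_phi _].
have [A Ab] := choice aff; have [b {}Ab] := choice Ab.
have [[oAV oAU] [phiVU psiUV] [phiK psiK] sphi1 spsi1] := d1.
have [[_ _] [phi0VU psi0UV] [phi0K psi0K] sphi0 spsi0] := d0.
pose ar (i : Gamma) (v : 'rV[R]_n) : arr G := phi1 ((i, v) : arr (action_groupoid a)).
pose sheet (i : Gamma) := [set v : 'rV[R]_n | V v /\ V (v *m A i + b i)].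
have sheetE i v : sheet i v -> arrows_over V ((i, v) : arr (action_groupoid a)).
  by move=> [Vv Vav]; split=> //=; rewrite Ab.
have arcE i v : sheet i v ->
    src (ar i v) = phi0 v /\ tgt (ar i v) = phi0 (v *m A i + b i).
  by move=> /sheetE /mem_set /st_phi; rewrite /= Ab.
have ar_cont i v : sheet i v -> {for v, continuous (ar i)}.
  move=> iv; apply: (@continuous_comp _ _ _
    (fun v : 'rV[R]_n => ((i, v) : (discrete_topology Gamma * 'rV[R]_n)%type)) phi1).
    have c1 : (fun=> i : discrete_topology Gamma) @ nbhs v -->
      (i : discrete_topology Gamma) by exact: cvg_cst.
    have c2 : id @ nbhs v --> v by exact: cvg_id.
    exact: cvg_pair c1 c2.
  exact: smooth_on_continuous sphi1 (sheetE _ _ iv).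
(* The first component of [psi1 g] tells the sheet of g; the second is the coordinate of its
   source. *)
have psi1E g : arrows_over U g ->
    [/\ sheet (psi1 g).1 (psi0 (src g)),
        psi0 (tgt g) = psi0 (src g) *m A (psi1 g).1 + b (psi1 g).1,
        ar (psi1 g).1 (psi0 (src g)) = g & (psi1 g).2 = psi0 (src g)].
  move=> Ug; have := psiUV g Ug; case E : (psi1 g) => [i v] Viv.
  have [sg tg] := st_phi _ (mem_set Viv).
  have gE : phi1 ((i, v) : arr (action_groupoid a)) = g by rewrite -E psiK ?inE.
  move: sg tg; rewrite gE /= => -> ->.
  have [Vv Vav] := Viv; rewrite /= in Vv Vav.
  rewrite !phi0K ?inE // /sheet /= -!Ab; split=> //.
have ar_open i : open (ar i @` sheet i).
  (* The image of a sheet consists of the arrows over U labelled i, an open condition because Gamma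
     is discrete. *)
  have -> : ar i @` sheet i = arrows_over U `&` psi1 @^-1` [set z | z.1 = i].
    apply/seteqP; split=> [_ [v iv <-]|g [Ug gi]].
      have Viv := sheetE _ _ iv; split; first exact: phiVU.
      by rewrite /preimage /= /ar phiK ?inE.
    have [ish _ gE _] := psi1E g Ug; exists (psi0 (src g)).
      by rewrite -gi.
    by rewrite -{1}gi.
  apply: open_preimage_on => //; first exact: spsi1.1.
  exact: open_sheet.
have onto g : arrows_over U g -> exists i, [/\ sheet i (psi0 (src g)),
    psi0 (tgt g) = psi0 (src g) *m A i + b i & ar i (psi0 (src g)) = g].
  by move=> /psi1E[? ? ? _]; exists (psi1 g).1.
have dims : U !=set0 -> mdim (arr G) = mdim (obj G).
  move=> [y Uy].
  (* The unit at y is a point of the arrow space over U, so both dimensions can be compared with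
     n. *)
  have Uu : arrows_over U (unit_arr y) by split; rewrite ?src_unit ?tgt_unit.
  have := diffeo_dim (charted_action_arr R n Gamma) charted_arr
    (ex_intro _ psi1 d1) (psiUV _ Uu).
  have := diffeo_dim (charted_cartesian R n) charted_obj
    (ex_intro _ psi0 d0) (psi0UV _ Uy).
  by move=> /= -> <-.
by exists (AffineModel cGamma d0 (fun i v iv => (arcE i v iv).1)
  (fun i v iv => (arcE i v iv).2) ar_cont ar_open onto dims).
Qed.

(** * Étaleness *)

Lemma smooth_tgt : smooth_on setT (@tgt _ G).
Proof. by case: lieG => _ _ [_ []]. Qed.

Lemma smooth_inv : smooth_on setT (@inv_arr _ G).
Proof. by case: lieG => _ _ _ _ []. Qed.

Lemma continuous_tgt : continuous (@tgt _ G).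
Proof. by move=> g; exact: smooth_on_continuous smooth_tgt I. Qed.

Lemma continuous_inv : continuous (@inv_arr _ G).
Proof. by move=> g; exact: smooth_on_continuous smooth_inv I. Qed.

Lemma continuous_unit : continuous (@unit_arr _ G).
Proof.
move=> x; apply: (smooth_on_continuous (A := setT)) => //.
by case: lieG => _ _ _ _ [].
Qed.

(** Continuity of the composition at a composable pair, obtained from the continuous local extension
    F that [smooth_on_subset] provides. *)
Lemma comp_nbhs (g h : arr G) (N : set (arr G)) : src g = tgt h ->
  nbhs (comp_arr g h) N -> exists P Q : set (arr G), [/\ nbhs g P, nbhs h Q &
    forall g' h', P g' -> Q h' -> src g' = tgt h' -> N (comp_arr g' h')].
Proof.
move=> gh nN; case: lieG => _ _ _ _ [_ _] /(_ (g, h) gh)[U [F [oU Ugh sF FE]]].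
have /FE e : (g, h) \in @composable _ G `&` U by apply: mem_set.
have := smooth_on_continuous sF Ugh; rewrite /prop_for /continuous_at -e.
move=> /(_ N nN) nF; have := filterI (open_nbhs_nbhs (conj oU Ugh)) nF.
move=> [[P Q] [/= Pg Qh] PQ]; exists P, Q; split=> // g' h' Pg' Qh' gh'.
have [Ugh' NF] := PQ (g', h') (conj Pg' Qh').
by have /FE -> : (g', h') \in @composable _ G `&` U by apply: mem_set.
Qed.

(** A is the sheet through the unit in a model, where the source of an arrow determines its
    parameter. *)
Lemma src_injective_near_unit (x : obj G) : exists A : set (arr G),
  [/\ open A, A (unit_arr x) &
      forall g h, A g -> A h -> src g = src h -> g = h].
Proof.
have [c cx] := affine_model_at x.
have cu : arrows_over (mdom c) (unit_arr x) by split; rewrite ?src_unit ?tgt_unit.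
have [i [iu _ iE]] := marrow_onto cu.
exists (marrow i @` msheet i); split; first exact: marrow_open.
  by exists (mpsi c (src (unit_arr x))).
move=> _ _ [v iv <-] [w iw <-]; rewrite !marrow_src // => vw.
have [_ _ [phiK _] _ _] := mdiffeo c.
by rewrite -(phiK v (mem_set iv.1)) vw phiK // inE; case: iw.
Qed.

(** For h and k near g with the same source, h k^-1 and the unit at the target of k both lie near
    the unit at the target of g and have the same source; so they are equal, and h = k. *)
Lemma src_locally_injective (g : arr G) : exists A : set (arr G),
  [/\ open A, A g & forall h k, A h -> A k -> src h = src k -> h = k].
Proof.
have [N [oN Nu injN]] := src_injective_near_unit (tgt g).
have nN : nbhs (comp_arr g (inv_arr g)) N.
  by rewrite comp_inv; exact: open_nbhs_nbhs.
have [P [Q [Pg Qg PQ]]] := comp_nbhs (esym (tgt_inv g)) nN.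
pose A := P `&` inv_arr (g := G) @^-1` Q `&` (unit_arr (g := G) \o tgt (g := G)) @^-1` N.
have nA : nbhs g A.
  apply: filterI; first by apply: filterI => //; exact: continuous_inv.
  apply: (continuous_comp (@continuous_tgt g) (@continuous_unit (tgt g))).
  exact: open_nbhs_nbhs.
exists A^°; split; [exact: open_interior|exact: nA|].
move=> h k /interior_subset[[Ph _] _] /interior_subset[[_ Qk] Nk] hk.
apply: eq_of_comp_inv => //; apply: injN => //.
  by apply: PQ => //; rewrite tgt_inv.
by rewrite src_comp ?tgt_inv // src_inv src_unit.
Qed.

Lemma dim_arr (x : obj G) : mdim (arr G) = mdim (obj G).
Proof.
by have [c cx] := affine_model_at x; apply: (mdim_obj c); exists x.
Qed.

Lemma src_etale (g : arr G) : exists A B sigma,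
  A g /\ inverse_diffeos A B (@src _ G) sigma.
Proof.
have [A [oA Ag injA]] := src_locally_injective g.
exists A, (src (g := G) @` A), ('pinv_(fun=> g) A (src (g := G))); split=> //.
apply: injective_submersion_inverse => //.
- exact: charted_arr.
- exact: charted_obj.
- exact: dim_arr (src g).
- by case: lieG => _ _ [].
- move=> h Ah; apply: pinvKV; last exact: mem_set.
  by move=> h' k' /set_mem Ah' /set_mem Ak'; exact: injA.
Qed.

Lemma inv_diffeo : inverse_diffeos setT setT (@inv_arr _ G) (@inv_arr _ G).
Proof.
split=> //; first by split; exact: openT.
- by split=> g _; exact: inv_involutive.
- exact: smooth_inv.
- exact: smooth_inv.
Qed.

(** The target is the source composed with the diffeomorphism [inv_arr]. *)
Lemma tgt_etale (g : arr G) : exists A B sigma,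
  A g /\ inverse_diffeos A B (@tgt _ G) sigma.
Proof.
have [A [B [sigma [Ag d]]]] := src_etale (inv_arr g).
have := inverse_diffeos_comp charted_arr charted_arr charted_obj inv_diffeo d.
have -> : src (g := G) \o inv_arr (g := G) = tgt (g := G).
  by apply/funext => h /=; rewrite src_inv.
move=> d'; eexists _, _, _; split; last exact: d'.
by split.
Qed.

Lemma etaleG : etale G.
Proof.
split=> [g|g|g]; first exact: dim_arr (src g).
  by have [A [B [sigma [Ag d]]]] := src_etale g; exists A, B; split=> //; exists sigma.
by have [A [B [sigma [Ag d]]]] := tgt_etale g; exists A, B; split=> //; exists sigma.
Qed.

(** * Orbits *)

Lemma gorbit_arrow (x p q : obj G) : gorbit x p -> gorbit x q ->
  exists g, src g = p /\ tgt g = q.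
Proof.
move=> [g sg <-] [h sh <-]; have sgh : src h = tgt (inv_arr g).
  by rewrite tgt_inv sh sg.
by exists (comp_arr h (inv_arr g)); rewrite src_comp // tgt_comp // src_inv.
Qed.

Lemma gorbit_refl (x : obj G) : gorbit x x.
Proof. by exists (unit_arr x); [exact: src_unit|exact: tgt_unit]. Qed.

Lemma gorbit_totally_disconnected (x : obj G) :
  smoothly_totally_disconnected (gorbit x).
Proof.
move=> k W p oW sp Wx w Ww.
have [c cw] := affine_model_at (p w).
have [[oV oU] [VU UV] [phiK psiK] sphi spsi] := mdiffeo c.
have oW' : open (W `&` p @^-1` mdom c) by apply: open_preimage_on => //; exact: sp.1.
have [r r0 rW] : exists2 r : R, 0 < r & forall z : 'rV[R]_k, `|z - w| < r ->
    W z /\ mdom c (p z).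
  have /nbhs_ballP[r /= r0 rW] := open_nbhs_nbhs (conj oW' (conj Ww cw)).
  by exists r => // z zr; apply: rW; rewrite -ball_normE /= distrC.
have E : forall v : 'rV[R]_k, `|v| < r / 2 -> mpsi c (p (v + w)) = mpsi c (p w).
  apply: (@countable_image_ball_constant _ _ _ (mpsi c \o p)) => [z /rW[Wz cz]|].
    apply: continuous_comp; first exact: smooth_on_continuous sp Wz.
    exact: smooth_on_continuous spsi cz.
  have := sub_countable (card_image_le (fun i => mact i (mpsi c (p w))) _) (mcountable c).
  apply: subset_countable => _ [z /rW[Wz cz] <-].
  (* An arrow from [p w] to [p z] over the model shows that the coordinates of [p z] are one of the
     countably many [mact i] of those of [p w]. *)
  have [g [sg tg]] := gorbit_arrow (Wx w Ww) (Wx z Wz).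
  have [|i [_ iE _]] := @marrow_onto _ _ c g; first by split; rewrite ?sg ?tg.
  by exists i => //; rewrite -[LHS]/(mact i (mpsi c (p w))) -sg -iE tg.
have : nbhs (w : 'rV[R]_k) [set z | `|z - w| < r / 2].
  apply/nbhs_ballP; exists (r / 2) => [|z]; first by rewrite /= divr_gt0.
  by rewrite -ball_normE /= distrC.
apply: filterS => z zr.
have zw : `|z - w| < r by apply: lt_trans zr _; rewrite ltr_pdivrMr // ltr_pMr // ltr1n.
have [_ cz] := rW z zw; have := E (z - w) zr; rewrite subrK => e.
by rewrite -(psiK (p z) (mem_set cz)) e psiK // inE.
Qed.

(** A continuous section kappa stays, near x, in an open set of arrows where the source is
    invertible, so it agrees there with the smooth inverse sigma. Shrinking so that the target is
    also invertible along sigma makes sigma a local bisection. *)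
Lemma lift_near_section (O : set (obj G)) (f : obj G -> obj G)
    (kappa : obj G -> arr G) (x : obj G) : open O -> O x ->
  {for x, continuous kappa} ->
  (forall y, O y -> src (kappa y) = y /\ tgt (kappa y) = f y) ->
  exists O' h, [/\ Psi O' h, O' x & \forall y \near x, f y = h y].
Proof.
move=> oO Ox ck kE; have [skx _] := kE x Ox.
have [A [B [sigma [Akx ds]]]] := src_etale (kappa x).
have [A' [B' [rho [A'kx dt]]]] := tgt_etale (kappa x).
have dh := inverse_diffeos_comp charted_obj charted_arr charted_obj
  (inverse_diffeos_sym ds) dt.
have [[oA oB] [AB BA] [srcK sigmaK] _ ssigma] := ds.
have Bx : B x by rewrite -skx; exact: AB.
have sx : sigma x = kappa x by rewrite -{1}skx srcK // inE.
have oO' : open (B `&` sigma @^-1` A') by case: dh => -[].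
exists (B `&` sigma @^-1` A'), (tgt (g := G) \o sigma); split.
- exists sigma => //; split=> //.
  + by apply: smooth_on_sub ssigma; exact: subIsetl.
  + by move=> y /set_mem[By _]; apply: sigmaK; exact: mem_set.
  + by exists (B' `&` rho @^-1` A), (src (g := G) \o rho).
- by split=> //=; rewrite sx.
have nA : \forall y \near x, A (kappa y) by apply: ck; exact: open_nbhs_nbhs.
apply: filterS2 nA (open_nbhs_nbhs (conj oO Ox)) => y Aky /kE[sky <-] /=.
by rewrite -{2}sky srcK // inE.
Qed.

Lemma lift_condition (U : set (obj G)) (f : obj G -> obj G) (x : obj G) :
  open U -> smooth_on U f -> {in U, forall y, gorbit (f y) = gorbit y} -> U x ->
  exists O h, [/\ Psi O h, O x & \forall y \near x, f y = h y].
Proof.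
move=> oU sf orb Ux.
have to_f y : U y -> exists g, src g = y /\ tgt g = f y.
  move=> Uy; have := gorbit_refl (f y); rewrite orb ?inE //.
  by move=> [g sg tg]; exists g.
have [g0 [sg0 tg0]] := to_f x Ux.
(* The inverse of [g0] goes from [f x] back to x; sigma is the local section of the source through
   it. *)
have [A [B [sigma [Ag ds]]]] := src_etale (inv_arr g0).
have [[oA oB] [AB BA] [srcK sigmaK] _ ssigma] := ds.
have sigmafx : sigma (f x) = inv_arr g0.
  by rewrite -tg0 -(src_inv g0) srcK // inE.
have Bfx : B (f x) by rewrite -tg0 -src_inv; exact: AB.
have src_sigma y : B y -> src (sigma y) = y by move=> By; apply: sigmaK; exact: mem_set.
have [c cx] := affine_model_at x.
have [[oV odom] [VU UV] [phiK psiK] sphi spsi] := mdiffeo c.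
have cMn := charted_cartesian R (mdimn c).
pose M := cartesian_space R (mdimn c).
pose v0 : M := mpsi c x.
have phiv0 : mphi c v0 = x by rewrite psiK // inE.
(* The map f, moved back to x by sigma, in the coordinates of the model. *)
pose h1 : M -> obj G := f \o mphi c.
pose V1 : set M := mV c `&` mphi c @^-1` U.
have oV1 : open V1 by apply: open_preimage_on => //; exact: sphi.1.
have sh1 : smooth_on V1 h1.
  apply: (@smooth_on_comp _ _ _ _ _ U) => //;
    [exact: charted_obj|exact: charted_obj|by move=> v []|].
  by apply: smooth_on_sub sphi; exact: subIsetl.
pose h2 : M -> arr G := sigma \o h1.
pose V2 : set M := V1 `&` h1 @^-1` B.
have oV2 : open V2 by apply: open_preimage_on => //; exact: sh1.1.
have sh2 : smooth_on V2 h2.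
  apply: (@smooth_on_comp _ _ _ _ _ B) => //;
    [exact: charted_obj|exact: charted_arr|by move=> v []|].
  by apply: smooth_on_sub sh1; exact: subIsetl.
pose h3 : M -> obj G := tgt (g := G) \o h2.
have sh3 : smooth_on V2 h3.
  apply: (@smooth_on_comp _ _ _ _ _ setT) => //;
    [exact: charted_arr|exact: charted_obj|exact: openT|].
  exact: smooth_tgt.
pose h4 : M -> M := mpsi c \o h3.
pose V4 : set M := V2 `&` h3 @^-1` mdom c.
have oV4 : open V4 by apply: open_preimage_on => //; exact: sh3.1.
have sh4 : smooth_on V4 h4.
  apply: (@smooth_on_comp _ _ _ _ _ (mdom c)) => //; [exact: charted_obj|by move=> v []|].
  by apply: smooth_on_sub sh3; exact: subIsetl.
have V4v0 : V4 v0.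
  rewrite /V4 /V2 /V1 /h3 /h2 /h1 /preimage /= phiv0 sigmafx tgt_inv sg0.
  by do !split => //; exact: UV.
have [r r0 rV] : exists2 r : R, 0 < r &
    forall v : 'rV[R]_(mdimn c), `|v - v0| < r -> V4 v.
  have /nbhs_ballP[r /= r0 rV] := open_nbhs_nbhs (conj oV4 V4v0).
  by exists r => // z zr; apply: rV; rewrite -ball_normE /= distrC.
(* An arrow from [mphi c v] to its image under f, followed by sigma, stays over the model, so it
   lies on some sheet i, which may depend on v. *)
have h4act v : V4 v -> exists i, h4 v = mact i v.
  move=> [[[Vv Uv] Bv] dv]; have [g [sg tg]] := to_f _ Uv.
  have gs : src (sigma (h1 v)) = tgt g by rewrite src_sigma.
  have dg : arrows_over (mdom c) (comp_arr (sigma (h1 v)) g).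
    by split; rewrite ?src_comp ?tgt_comp // sg; exact: VU.
  have [i [_ + _]] := marrow_onto dg.
  rewrite src_comp // tgt_comp // sg phiK ?inE // => e; by exists i.
have C4 : Ck 1 [set v : 'rV[R]_(mdimn c) | `|v - v0| < r] h4.
  by apply: Ck_sub (smooth_on_Cinfty oV4 sh4 1) => v /rV.
(* Rigidity yields one index i for a whole ball around [v0]. *)
have [i hi] := affine_family_rigid (mcountable c) C4
  (fun v vr => h4act v (rV v vr)) r0.
have {}hi (v : 'rV[R]_(mdimn c)) : `|v - v0| < r / 2 -> V4 v /\ h4 v = mact i v.
  move=> vr; have := hi (v - v0) vr; rewrite subrK => h4v; split=> //.
  by apply: rV; apply: lt_trans vr _; rewrite ltr_pdivrMr // ltr_pMr // ltr1n.
pose ball0 : set M := [set v : 'rV[R]_(mdimn c) | `|v - v0| < r / 2].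
have oball0 : open ball0.
  have -> : ball0 = ball (v0 : 'rV[R]_(mdimn c)) (r / 2).
    by apply/seteqP; split=> v; rewrite -ball_normE /ball0 /= distrC.
  exact: ball_open.
pose O : set (obj G) := mdom c `&` mpsi c @^-1` ball0.
have oO : open O by apply: open_preimage_on => //; exact: spsi.1.
have Ox : O x by split=> //; rewrite /preimage /ball0 /= subrr normr0 divr_gt0.
(* The arrow of sheet i leads from y to the target of [sigma (f y)], and the inverse of
   [sigma (f y)] leads from there to [f y]; hence kappa is a lift of f. *)
pose kappa y := comp_arr (inv_arr (sigma (f y))) (marrow i (mpsi c y)).
have Oy y : O y -> [/\ U y, B (f y), msheet i (mpsi c y) &
    mphi c (mact i (mpsi c y)) = tgt (sigma (f y))].
  move=> [dy /hi[[[[Vy Uy] By] d3] h4y]].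
  have py : mphi c (mpsi c y) = y by rewrite psiK // inE.
  have h3y : h3 (mpsi c y) = tgt (sigma (f y)) by rewrite /h3 /h2 /h1 /= py.
  rewrite /preimage /= py in Uy; rewrite /preimage /h1 /= py in By.
  rewrite /preimage /= h3y in d3.
  have e : mact i (mpsi c y) = mpsi c (tgt (sigma (f y))) by rewrite -h4y /h4 /= h3y.
  split=> //; last by rewrite e psiK // inE.
  by split; [exact: UV|rewrite e; exact: UV].
have comp_ok y : O y ->
    src (inv_arr (sigma (f y))) = tgt (marrow i (mpsi c y)).
  by move=> /Oy[_ By iy e]; rewrite src_inv marrow_tgt.
apply: (@lift_near_section O f kappa) => // [|y Oyy].
- move=> N nN; have [P [Q [nP nQ PQ]]] := comp_nbhs (comp_ok x Ox) nN.
  have [_ _ ix _] := Oy x Ox.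
  have cP : {for x, continuous (inv_arr (g := G) \o (sigma \o f))}.
    apply: continuous_comp; last exact: continuous_inv.
    apply: continuous_comp; first exact: smooth_on_continuous sf Ux.
    exact: smooth_on_continuous ssigma Bfx.
  have cQ : {for x, continuous (marrow i \o mpsi c)}.
    apply: continuous_comp; first exact: smooth_on_continuous spsi cx.
    exact: marrow_continuous ix.
  have xP : \forall y \near x, P (inv_arr (sigma (f y))) := cP P nP.
  have xQ : \forall y \near x, Q (marrow i (mpsi c y)) := cQ Q nQ.
  apply: filterS3 (open_nbhs_nbhs (conj oO Ox)) xP xQ => y Oyy Py Qy.
  exact: (PQ _ _ Py Qy (comp_ok y Oyy)).
- have [_ By iy _] := Oy y Oyy.
  rewrite /kappa src_comp ?tgt_comp ?comp_ok // tgt_inv src_sigma // marrow_src //.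
  by rewrite psiK // inE; case: Oyy.
Qed.

End Quasifold.

Theorem proposition3p22 (R : realType) (G : groupoid_data R) :
  quasifold_groupoid G -> effective G -> lift_complete G.
Proof.
move=> [lieG _ models] effG; split=> //.
- exact: etaleG lieG models.
- exact: gorbit_totally_disconnected lieG models.
- by move=> U f oU sf orb x Ux; exact: (lift_condition lieG models oU sf orb Ux).
Qed.
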